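(* Let $\lambda=(\lambda_1,\ldots,\lambda_{l(\lambda)})$ be an integer partition and $2\lambda:=(2\lambda_1,\ldots,2\lambda_{l(\lambda)})$. The coefficient $b_{2\lambda}(\mathrm{Td}^{1/2})$ of the Chern number $C_{2\lambda}[\cdot]$ in the $\mathrm{Td}^{1/2}$-genus is given by $$b_{2\lambda}(\mathrm{Td}^{1/2})=\frac{(-1)^{|\lambda|-l(\lambda)}}{(2\pi)^{2|\lambda|}\prod_i m_i(\lambda)!}\cdot\zeta^{\star}_S(2\lambda_1,\ldots,2\lambda_{l(\lambda)}).$$ In particular, the coefficient $b_{2\lambda}(\mathrm{Td}^{1/2})$ is nonzero for every partition $\lambda$; it is positive if $|\lambda|-l(\lambda)$ is even and negative if $|\lambda|-l(\lambda)$ is odd.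
   Context: An integer partition $\lambda=(\lambda_1,\ldots,\lambda_{l})$ is a finite sequence of positive integers $\lambda_1\ge\cdots\ge\lambda_l\ge1$; $l(\lambda)=l$ is its length, $|\lambda|=\sum_i\lambda_i$ its weight, and $m_i(\lambda)$ is the number of parts equal to $i$; $0!:=1$. Complex genera: a complex genus $\varphi$ corresponds to a formal power series $Q(x)=1+\sum_{i\ge1}a_ix^i$. The coefficients $b_\lambda(\varphi)$, indexed by integer partitions $\lambda$, are defined by the expansion $$\prod_{i=1}^\infty Q(x_i)=1+\sum_{|\lambda|\ge1}b_\lambda(\varphi)\,e_\lambda(\mathbf{x}),\qquad e_\lambda=\prod_{i=1}^{l(\lambda)}e_{\lambda_i},$$ where $e_k=e_k(x_1,x_2,\ldots)$ is the $k$-th elementary symmetric function in countably many commuting variables. For a compact almost-complex manifold $M$ of real dimension $2n$ with Chern classes $c_i$, $\varphi(M)=\sum_{|\lambda|=n}b_\lambda(\varphi)C_\lambda[M]$, where $C_\lambda[M]=\int_M c_{\lambda_1}\cdots c_{\lambda_{l(\lambda)}}$ is the Chern number; so $b_\lambda(\varphi)$ is the coefficient in front of $C_\lambda[\cdot]$. The $\mathrm{Td}^{1/2}$-genus is the complex genus with $Q(x)=\left(\frac{x}{1-e^{-x}}\right)^{1/2}$ (the square root with constant term $1$). For real $t_1,\ldots,t_r>1$, $$\zeta^\star(t_1,\ldots,t_r)=\sum_{n_1\ge n_2\ge\cdots\ge n_r\ge1}\frac{1}{n_1^{t_1}\cdots n_r^{t_r}},\qquad \zeta^\star_S(t_1,\ldots,t_r)=\sum_{\sigma\in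 S_r}\zeta^\star(t_{\sigma(1)},\ldots,t_{\sigma(r)}),$$ where $S_r$ is the permutation group of $\{1,\ldots,r\}$. *)

(* Defs.v *)
From HB Require Import structures.
From mathcomp Require Import all_boot all_order all_algebra all_fingroup finmap.
From mathcomp Require Import monalg.
From mathcomp Require Import all_classical all_reals all_analysis.

Set Implicit Arguments.
Unset Strict Implicit.
Unset Printing Implicit Defensive.

Import Order.TTheory GRing.Theory Num.Theory.

Local Open Scope classical_set_scope.
Local Open Scope ring_scope.

Definition is_partition (l : seq nat) : bool := sorted geq l && all (ltn 0%N) l.

(** A series in one variable is identified with its coefficient sequence. *)
Section UnivariateSeries.
Variable R : realType.

Definition ps_mul (f g : nat -> R) (n : nat) : R :=
  \sum_(i < n.+1) f i * g (n - i)%N.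

Definition ps_X (n : nat) : R := (n == 1)%N%:R.

(** 1 - exp(-x) *)
Definition ps_one_sub_expN (n : nat) : R := (n == 0)%N%:R - (-1) ^+ n / n`!%:R.

(** Q = (x / (1 - exp(-x)))^(1/2), the root with constant term 1.  The divisor
    has no constant term, so the quotient is expressed by multiplying it out;
    R[[x]] being a domain, Q is uniquely determined. *)
Definition is_Td_half (Q : nat -> R) : Prop :=
  Q 0%N = 1 /\ ps_mul (ps_mul Q Q) ps_one_sub_expN = ps_X.

End UnivariateSeries.

(** A series in the variables x_0, x_1, ... is the function giving its
    coefficient at each monomial. *)
Section MultivariateSeries.
Variable R : realType.
Local Notation mon := {cmonom nat}.

Definition factorizations (m : mon) : set (mon * mon) :=
  [set p | mmul p.1 p.2 = m].

(** Hence the [\sum_(p \in _)] below never takes its default value. *)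
Lemma finite_factorizations (m : mon) : finite_set (factorizations m).
Proof.
pose d (f : {ffun finsupp m -> 'I_(mdeg m).+1}) : mon :=
  mkcmonom [fsfun i : finsupp m => f i : nat | 0%N].
pose g f := (d f, divcm m (d f)).
apply: (@sub_finite_set _ _ (g @` setT)); last exact/finite_image/finite_finset.
case=> p q /= pqm; have mE i : m i = (p i + q i)%N by rewrite -pqm cmM.
have le_p i : (p i <= m i)%N by rewrite mE leq_addr.
have le_d i : (p i <= mdeg m)%N.
  rewrite -pqm mdegM; apply: leq_trans (leq_addr _ _).
  case: (mdomP p i) => // pi.
  by rewrite mdegE (big_fsetD1 i pi) leq_addr.
exists [ffun i => inord (p (val i))] => //.
have dE : d [ffun i => inord (p (val i))] = p.
  apply/eqP/cmP => i; rewrite /d cmE /= fsfun_ffun.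
  case: insubP => [u _ <-|] /=.
    by rewrite ffunE inordK // ltnS le_d.
  by rewrite -cmE_eq0 => /eqP mi; move: (le_p i); rewrite mi leqn0 => /eqP.
rewrite /g dE; congr pair; apply/eqP/cmP => i.
rewrite /divcm cmE fsfun_ffun; case: insubP => [u _ <-|] /=.
  by rewrite mE addKn.
by rewrite -cmE_eq0 mE addn_eq0 => /andP[_ /eqP].
Qed.

Definition mps_mul (f g : mon -> R) (m : mon) : R :=
  \sum_(p \in factorizations m) f p.1 * g p.2.

Definition mps_one (m : mon) : R := (mdeg m == 0)%N%:R.

Definition elem_sym (k : nat) (m : mon) : R :=
  ((mdeg m == k) && all (fun i => m i <= 1)%N (finsupp m))%:R.

Definition elem_part (l : seq nat) : mon -> R :=
  foldr (fun k f => mps_mul (elem_sym k) f) mps_one l.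

(** The infinite product of the Q(x_i), for Q of constant term 1: a monomial
    draws the constant term 1 from all but finitely many factors. *)
Definition prod_series (Q : nat -> R) (m : mon) : R :=
  \prod_(i <- finsupp m) Q (m i).

(** prod_i Q(x_i) = sum_l b_l e_l over all partitions l; the empty one
    contributes the leading 1.  Only the l of weight [mdeg m] contribute at m,
    so each coefficient is a finite sum; the b_l are uniquely determined as the
    e_k are algebraically independent. *)
Definition is_genus_coef (Q : nat -> R) (b : seq nat -> R) : Prop :=
  Q 0%N = 1 /\
  forall m : mon, prod_series Q m =
    \sum_(l \in [set l | is_partition l]) b l * elem_part l m.

End MultivariateSeries.

Section ZetaStar.
Variable R : realType.

Definition star_indices (r : nat) : set {ffun 'I_r -> nat} :=
  [set n | (forall i, 1 <= n i)%N /\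
           (forall i j : 'I_r, (i <= j)%N -> (n j <= n i)%N)].

(** Sums of positive terms, hence taken in [\bar R]; finite when all t_i > 1. *)
Definition zeta_star (r : nat) (t : 'I_r -> R) : \bar R :=
  \esum_(n in @star_indices r) ((\prod_(i < r) ((n i)%:R `^ t i))^-1)%:E.

Definition zeta_starS (r : nat) (t : 'I_r -> R) : \bar R :=
  (\sum_(s : 'S_r) zeta_star (fun i => t (s i)))%E.

End ZetaStar.

(* Main.v *)
Require Import Defs.
From HB Require Import structures.
From mathcomp Require Import all_boot all_order all_algebra all_fingroup finmap.
From mathcomp Require Import monalg.
From mathcomp Require Import all_classical all_reals all_analysis.
From mathcomp Require Import complex ring zify.

(** Factor [Q] formally as the product of the [1 + y_j x]. Then the product of
    the [Q(x_i)] is the product of all [1 + y_j x_i], and the dual Cauchy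
    identity expands it as the sum of the [m_l(y) e_l(x)], with [m_l] the
    monomial symmetric functions. As the [e_l] are linearly independent, the
    coefficient [b_l] is [m_l(y)] ([genus_coef_aug_monomial]). To have actual
    roots, [Q] is truncated at the degree that matters and the [y_j] are taken
    in the complex numbers.

    The product of [m_l(y)] with the factorials of the multiplicities of [l] is
    the augmented monomial [M(l)], the sum of [y_(f 1)^(l_1) ... y_(f r)^(l_r)]
    over injective [f]. It is determined by the power sums [p_k] through
    [M(k, l) = p_k M(l) - \sum_i M(l with l_i + k in place of l_i)]
    ([aug_monomial_rec]). The symmetrized zeta-star sums [S], a sum over all
    maps [f] weighted by the factorials of the sizes of the fibres, satisfy the
    same recursion with a plus sign ([sym_star_sum_rec]), in which the power sum
    is [zeta(k)].

    It remains to see that the even power sums are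
    [p_(2k) = (-1)^(k-1) zeta(2k) / (2 pi)^(2k)]. The differential equation
    [2 x Q' = Q (1 + x - Q^2)] gives [p_(2k)] as half the coefficient of
    [x^(2k)] in the Todd series [Q^2 = x / (1 - exp(-x))]
    ([Td_half_newton]). Euler's formula for that coefficient is proved in two
    steps. The squared cotangents of the multiples of [pi / (2m+1)] have
    explicit elementary symmetric functions, and after scaling they approximate
    the [1/n^2]; in the limit, Newton's identities relate the [zeta(2k)] to the
    series [sinh(x/2) / (x/2)] ([even_zeta]). The logarithmic derivative of that
    series is in turn expressed by the Todd series ([Td_sinh]). The signs then
    combine into [(-1)^(|l| - r)] by the two recursions
    ([aug_monomial_lim_star]), and [S] is positive. *)

Set Implicit Arguments.
Unset Strict Implicit.
Unset Printing Implicit Defensive.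

Import Order.TTheory GRing.Theory Num.Theory numFieldNormedType.Exports.

Local Open Scope ring_scope.

(** * Augmented monomials, star sums and power sums *)

Section Lists.
Variable K : comNzRingType.
Implicit Types (x y : K) (a : nat) (xs ys : seq K) (k : nat) (s t : seq nat).

(** All ways of taking one entry out of a list, and of enlarging one entry by
    [k]; entries count with their position, as indices do. *)
Fixpoint picks s : seq (nat * seq nat) :=
  if s is a :: t then (a, t) :: [seq (p.1, a :: p.2) | p <- picks t] else [::].

Fixpoint bumps k s : seq (seq nat) :=
  if s is a :: t then (a + k :: t)%N :: [seq a :: u | u <- bumps k t] else [::].

Lemma picks_cons a s :
  picks (a :: s) = (a, s) :: [seq (p.1, a :: p.2) | p <- picks s].
Proof. by []. Qed.

Lemma bumps_cons k a s :
  bumps k (a :: s) = (a + k :: s)%N :: [seq a :: u | u <- bumps k s].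
Proof. by []. Qed.

Arguments picks : simpl never.
Arguments bumps : simpl never.

Lemma size_bumps k s u : u \in bumps k s -> size u = size s.
Proof.
elim: s u => [//|a t IH] u; rewrite bumps_cons inE => /predU1P[-> //|/mapP[v vt ->]] /=.
by rewrite (IH v).
Qed.

Lemma sumn_bumps k s u : u \in bumps k s -> sumn u = (k + sumn s)%N.
Proof.
elim: s u => [//|a t IH] u; rewrite bumps_cons inE => /predU1P[-> /=|/mapP[v vt ->] /=].
  by rewrite -addnA addnCA.
by rewrite (IH v) // addnCA.
Qed.

Lemma bumps_gt0 k s u :
  all (ltn 0%N) s -> u \in bumps k s -> all (ltn 0%N) u.
Proof.
elim: s u => [//|a t IH] u /= /andP[a0 t0].
rewrite bumps_cons inE => /predU1P[-> /=|/mapP[v vt ->] /=]; last by rewrite a0 (IH v).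
by rewrite t0 addn_gt0 a0.
Qed.

Lemma bumps_map_double k s :
  bumps (2 * k) [seq (2 * i)%N | i <- s] =
  [seq [seq (2 * i)%N | i <- u] | u <- bumps k s].
Proof.
elim: s => //= a s IH; rewrite !bumps_cons IH /= mulnDr; congr cons.
by rewrite -!map_comp; apply: eq_map.
Qed.

Lemma perm_picks s p : p \in picks s -> perm_eq s (p.1 :: p.2).
Proof.
elim: s p => //= a s IH p; rewrite picks_cons inE => /predU1P[-> //|/mapP[q qs ->] /=].
rewrite (perm_trans _ (_ : perm_eq (a :: q.1 :: q.2) _)) ?perm_cons ?IH //.
by rewrite (perm_catCA [:: a] [:: q.1]).
Qed.

Lemma size_picks s p : p \in picks s -> size s = (size p.2).+1.
Proof. by move=> /perm_picks /perm_size. Qed.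

Lemma sum_picks_fst (V : nmodType) (f : nat -> V) s :
  \sum_(p <- picks s) f p.1 = \sum_(a <- s) f a.
Proof.
elim: s => [|a s IH] /=; first by rewrite !big_nil.
by rewrite picks_cons !big_cons big_map IH.
Qed.

Lemma sum_picks_nth (V : nmodType) (F : nat -> seq nat -> V) s :
  \sum_(p <- picks s) F p.1 p.2 =
  \sum_(i < size s) F (nth 0%N s i) (take i s ++ drop i.+1 s).
Proof.
elim: s F => [|a s IH] F /=; first by rewrite big_nil big_ord0.
by rewrite picks_cons big_cons big_map big_ord_recl /= drop0 (IH (fun b u => F b (a :: u))).
Qed.

(** Enlarging an entry and picking one commute, except that the entry picked
    may be the one that was enlarged. *)
Lemma sum_bumps_picks (V : nmodType) (G : nat -> seq nat -> V) k s :
  \sum_(u <- bumps k s) \sum_(p <- picks u) G p.1 p.2 =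
  \sum_(p <- picks s) G (p.1 + k)%N p.2 +
  \sum_(p <- picks s) \sum_(u <- bumps k p.2) G p.1 u.
Proof.
elim: s G => [|a s IH] G; first by rewrite !big_nil addr0.
rewrite !picks_cons bumps_cons !big_cons /= !big_map /=.
under [X in _ + X = _]eq_bigr => u _ do rewrite picks_cons big_cons big_map /=.
rewrite big_split /= (IH (fun b u => G b (a :: u))).
under [X in _ = _ + (_ + X)]eq_bigr => u _ do
  rewrite bumps_cons big_cons big_map /=.
rewrite !big_split /= -!addrA; congr (_ + _).
by rewrite addrCA [RHS]addrCA; congr (_ + _); rewrite addrCA.
Qed.

Definition power_sum xs k : K := \sum_(x <- xs) x ^+ k.

Lemma power_sum_cons x xs k :
  power_sum (x :: xs) k = x ^+ k + power_sum xs k.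
Proof. exact: big_cons. Qed.

(** [aug_monomial ys s] is the sum of [y_(f 1) ^ s_1 * ... * y_(f r) ^ s_r]
    over the injections [f] of the entries of [s] into those of [ys]; only one
    entry of [s] can go to the head of [ys]. *)
Fixpoint aug_monomial ys s : K :=
  if ys is y :: ys' then
    aug_monomial ys' s + \sum_(p <- picks s) y ^+ p.1 * aug_monomial ys' p.2
  else (s == [::])%:R.

Lemma aug_monomial_nil ys : aug_monomial ys [::] = 1.
Proof. by elim: ys => [//|y ys IH] /=; rewrite IH big_nil addr0. Qed.

(** Multiplying by [p_k] places one more entry [k] anywhere: on a variable not
    yet used, or on that of an earlier entry, which is thereby enlarged. *)
Lemma aug_monomial_rec ys k s :
  aug_monomial ys (k :: s) =
  power_sum ys k * aug_monomial ys s - \sum_(u <- bumps k s) aug_monomial ys u.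
Proof.
elim: ys k s => [|y ys IH] k s.
  rewrite /= /power_sum big_nil mul0r big_seq big1 ?subr0 // => u.
  by case: s => [//|a s] /size_bumps; case: u.
rewrite power_sum_cons /= picks_cons big_cons big_map /= IH.
rewrite [in X in _ = _ - X]big_split /=.
rewrite (sum_bumps_picks (fun a u => y ^+ a * aug_monomial ys u)).
under [X in _ + (_ + X) = _]eq_bigr => p _ do rewrite IH mulrBr mulr_sumr mulrCA.
rewrite sumrB -mulr_sumr.
under [X in _ = _ - (_ + (X + _))]eq_bigr => p _ do
  rewrite addnC exprD -mulrA.
rewrite -mulr_sumr; ring.
Qed.

(** The sum of [x_(n_1) ^ k_1 * ... * x_(n_r) ^ k_r] over weakly monotone choices
    of positions in [xs]: the first exponent either skips the head of [xs] for
    good, or takes it and leaves it available. With [xs = 1/N, ..., 1/1] this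
    is the truncated zeta-star sum. *)
Fixpoint star_sum xs : seq nat -> K :=
  fix star_sum_xs t : K :=
  if t is k :: t' then
    if xs is x :: xs' then star_sum xs' t + x ^+ k * star_sum_xs t' else 0
  else 1.

Arguments star_sum : simpl never.

Lemma star_sum0 xs : star_sum xs [::] = 1. Proof. by case: xs. Qed.
Lemma star_sum_nil k t : star_sum [::] (k :: t) = 0. Proof. by []. Qed.
Lemma star_sum_cons x xs k t : star_sum (x :: xs) (k :: t) =
  star_sum xs (k :: t) + x ^+ k * star_sum (x :: xs) t.
Proof. by []. Qed.

(** [s] with its entries permuted by [sg]; the size is a separate parameter so
    that removing an entry need not be transported along an equality of sizes. *)
Definition permute r (s : seq nat) (sg : 'S_r) : seq nat :=
  [seq nth 0%N s (sg i) | i <- enum 'I_r].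

Definition sym_star_sum xs s : K :=
  \sum_(sg : 'S_(size s)) star_sum xs (permute s sg).

Lemma sym_star_sumE n xs s : size s = n ->
  sym_star_sum xs s = \sum_(sg : 'S_n) star_sum xs (permute s sg).
Proof. by move=> <-. Qed.

(** A permutation is determined by the image of the first index and by a
    permutation of the rest. *)
Lemma big_perm_lift (V : nmodType) n (G : 'S_n.+1 -> V) :
  \sum_(sg : 'S_n.+1) G sg =
  \sum_(i < n.+1) \sum_(tau : 'S_n) G (lift_perm ord0 i tau).
Proof.
rewrite (partition_big (fun sg : 'S_n.+1 => sg ord0) xpredT) //=.
apply: eq_bigr => i _.
have inj : injective (@lift_perm n ord0 i).
  move=> s t /permP E; apply/permP => j; apply: (@lift_inj _ i).
  by rewrite -!(lift_perm_lift ord0).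
rewrite (reindex (lift_perm ord0 i)) /=; last first.
  pose ulsf (s : 'S_n.+1) (k : 'I_n) := odflt k (unlift (s ord0) (s (lift ord0 k))).
  have ulsfK (s : 'S_n.+1) (k : 'I_n) : lift (s ord0) (ulsf s k) = s (lift ord0 k).
    rewrite /ulsf; have:= neq_lift ord0 k.
    by rewrite -(can_eq (permK s)) => /unlift_some[] ? ? ->.
  have inj_ulsf (s : 'S_n.+1) : injective (ulsf s).
    by move=> j k E; apply/(@lift_inj _ ord0)/(@perm_inj _ s); rewrite -!ulsfK E.
  exists (fun s : 'S_n.+1 => perm (inj_ulsf s)) => [s _|s].
    apply/permP => j; apply: (@lift_inj _ i).
    by rewrite permE -{1}(lift_perm_id ord0 i s) ulsfK lift_perm_lift.
  rewrite inE => /eqP si; apply/permP => k.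
  case: (unliftP ord0 k) => [j ->|->]; last by rewrite lift_perm_id.
  by rewrite lift_perm_lift permE -si ulsfK.
by apply: eq_bigl => s; rewrite lift_perm_id eqxx.
Qed.

Lemma permute_lift n s (i : 'I_n.+1) (tau : 'S_n) : size s = n.+1 ->
  permute s (lift_perm ord0 i tau) =
  nth 0%N s i :: permute (take i s ++ drop i.+1 s) tau.
Proof.
move=> sn; rewrite /permute enum_ordSl /= lift_perm_id; congr cons.
rewrite -map_comp; apply: eq_map => j /=; rewrite lift_perm_lift.
rewrite nth_cat size_takel ?sn ?(ltnW (ltn_ord i)) // /=.
rewrite /bump; case: leqP => h; first by rewrite nth_drop; congr nth; lia.
by rewrite nth_take // add0n.
Qed.

Lemma sym_star_sum_head (F : seq nat -> K) s : (0 < size s)%N ->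
  \sum_(sg : 'S_(size s)) F (permute s sg) =
  \sum_(p <- picks s) \sum_(sg : 'S_(size p.2)) F (p.1 :: permute p.2 sg).
Proof.
move=> s0; rewrite (sum_picks_nth (fun a u =>
  \sum_(sg : 'S_(size u)) F (a :: permute u sg))).
case n_def : (size s) s0 => [//|n] _.
rewrite big_perm_lift; apply: eq_bigr => i _.
have -> : size (take i s ++ drop i.+1 s) = n.
  by rewrite size_cat size_drop size_takel n_def; have := ltn_ord i; lia.
by apply: eq_bigr => tau _; rewrite permute_lift.
Qed.

Lemma sym_star_sum0 xs : sym_star_sum xs [::] = 1.
Proof.
rewrite /sym_star_sum (eq_bigr (fun=> 1)) => [|sg _].
  by rewrite sumr_const card_Sn.
by rewrite /permute enum_ord0 /= star_sum0.
Qed.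

Lemma sym_star_sum_nil s : (0 < size s)%N -> sym_star_sum [::] s = 0.
Proof.
move=> s0; rewrite /sym_star_sum sym_star_sum_head // big1 // => p _.
by rewrite big1.
Qed.

Lemma sym_star_sum_cons x xs s : (0 < size s)%N ->
  sym_star_sum (x :: xs) s =
  sym_star_sum xs s + \sum_(p <- picks s) x ^+ p.1 * sym_star_sum (x :: xs) p.2.
Proof.
move=> s0; rewrite /sym_star_sum !sym_star_sum_head // -big_split /=.
apply: eq_bigr => p _; rewrite -/(sym_star_sum _ _).
under eq_bigr => sg _ do rewrite star_sum_cons.
by rewrite big_split /= mulr_sumr.
Qed.

(** The recursion of [aug_monomial_rec], with the opposite sign. Both functions
    sum a weight over all maps from the entries to the variables: a fibre of
    size [n] weighs [n`!] here, the number of orders that sort it, and weighs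
    [(1 - 0) * (1 - 1) * ... * (1 - (n - 1))] for augmented monomials, that is
    [1] if [n <= 1] and [0] otherwise. An entry joining a fibre of size [n]
    multiplies the weight by [1 + n] in one case and by [1 - n] in the other. *)
Lemma sym_star_sum_rec xs k s :
  sym_star_sum xs (k :: s) =
  power_sum xs k * sym_star_sum xs s + \sum_(u <- bumps k s) sym_star_sum xs u.
Proof.
elim: xs k s => [|x xs IHxs] k s.
  rewrite sym_star_sum_nil // /power_sum big_nil mul0r big_seq big1 ?addr0 //.
  by move=> u; case: s => [//|a s] /size_bumps us; rewrite sym_star_sum_nil ?us.
have [n ns] := ubnP (size s); elim: n s ns k => // n IH s ns k.
rewrite sym_star_sum_cons // picks_cons big_cons big_map /= IHxs.
have -> : \sum_(p <- picks s) x ^+ p.1 * sym_star_sum (x :: xs) (k :: p.2) =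
  power_sum (x :: xs) k * (\sum_(p <- picks s) x ^+ p.1 * sym_star_sum (x :: xs) p.2)
  + \sum_(p <- picks s) \sum_(u <- bumps k p.2) x ^+ p.1 * sym_star_sum (x :: xs) u.
  rewrite [X in _ = X + _]mulr_sumr -big_split /=.
  apply: eq_big_seq => p ps; rewrite IH; last by rewrite (size_picks ps) in ns.
  by rewrite mulrDr mulrCA; congr (_ + _); exact: mulr_sumr.
case: s ns => [|a s] ns.
  by rewrite !sym_star_sum0 !big_nil power_sum_cons; ring.
rewrite [sym_star_sum (x :: xs) (a :: s)]sym_star_sum_cons //.
have -> : \sum_(u <- bumps k (a :: s)) sym_star_sum (x :: xs) u =
  \sum_(u <- bumps k (a :: s)) (sym_star_sum xs u +
     \sum_(p <- picks u) x ^+ p.1 * sym_star_sum (x :: xs) p.2).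
  apply: eq_big_seq => u /size_bumps us.
  by rewrite sym_star_sum_cons // us.
rewrite big_split /=.
rewrite (sum_bumps_picks (fun b u => x ^+ b * sym_star_sum (x :: xs) u)).
set B := \sum_(p <- picks (a :: s)) \sum_(u <- _) _.
set C := \sum_(p <- picks (a :: s)) x ^+ (p.1 + k) * _.
have -> : C = x ^+ k * \sum_(p <- picks (a :: s)) x ^+ p.1 * sym_star_sum (x :: xs) p.2.
  by rewrite mulr_sumr; apply: eq_bigr => p _; rewrite addnC exprD mulrA.
rewrite power_sum_cons; ring.
Qed.

(** The elementary symmetric functions of the entries of [ys]. *)
Fixpoint esym_seq ys (n : nat) : K :=
  if ys is y :: ys' then
    esym_seq ys' n + (if n is n'.+1 then y * esym_seq ys' n' else 0)
  else (n == 0)%:R.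

Lemma esym_seq0 ys : esym_seq ys 0 = 1.
Proof. by elim: ys => //= y ys ->; rewrite addr0. Qed.

(** Adjoining [y] to [ys] multiplies the generating series by [1 + y x], hence
    adds [y x / (1 + y x)] to its logarithmic derivative; that contribution
    telescopes against [1 + y x]. *)
Lemma newton ys n :
  n%:R * esym_seq ys n =
  \sum_(k < n) (-1) ^+ k * power_sum ys k.+1 * esym_seq ys (n - k.+1)%N.
Proof.
elim: ys n => [|y ys IH] n.
  rewrite big1 => [|i _]; last by rewrite /power_sum big_nil mulr0 mul0r.
  by case: n => [|n]; rewrite /= ?mul0r ?mulr0.
case: n => [|n]; first by rewrite big_ord0 mul0r.
have Y (m : nat) : \sum_(k < m.+1) (-1) ^+ k * y ^+ k.+1 * esym_seq (y :: ys) (m - k)%N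
   = y * esym_seq ys m.
  elim: m => [|m IHm].
    by rewrite big_ord_recl big_ord0 /= expr0 expr1 !addr0 mul1r.
  rewrite big_ord_recl /= subn0 expr0 expr1 mul1r.
  under eq_bigr => i _ do rewrite /bump /= add1n subSS exprS [y ^+ _.+2]exprS
    mulN1r !mulNr mulrCA -mulrA -mulNr.
  by rewrite -mulr_sumr IHm; ring.
have distr (a b c d : K) : a * (b + c) * d = a * b * d + a * c * d by ring.
under eq_bigr => i _ do rewrite power_sum_cons distr subSS.
rewrite big_split /= Y.
under eq_bigr => i _ do rewrite mulrDr.
rewrite big_split /=.
have -> : \sum_(i < n.+1) (-1) ^+ i * power_sum ys i.+1 * esym_seq ys (n - i)%N =
  n.+1%:R * esym_seq ys n.+1.
  by rewrite IH; apply: eq_bigr => i _; rewrite subSS.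
have -> : \sum_(i < n.+1) (-1) ^+ i * power_sum ys i.+1 *
   (if (n - i)%N is n'.+1 then y * esym_seq ys n' else 0) =
  y * (n%:R * esym_seq ys n).
  rewrite big_ord_recr /= subnn mulr0 addr0 IH mulr_sumr.
  apply: eq_bigr => i _.
  by rewrite (_ : (n - i)%N = (n - i.+1).+1) 1?mulrCA // subnSK.
rewrite -[n.+1]addn1 natrD; ring.
Qed.

(** As [e 0 = 1], the identities form a unitriangular system for the [nt k]. *)
Lemma newton_unique (e nt nt' : nat -> K) D : e 0%N = 1 ->
  (forall n, (n <= D)%N ->
     \sum_(k < n) nt k.+1 * e (n - k.+1)%N = \sum_(k < n) nt' k.+1 * e (n - k.+1)%N) ->
  forall k, (0 < k <= D)%N -> nt k = nt' k.
Proof.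
move=> e0 H k; elim/ltn_ind: k => -[//|k] IH /= kD.
have := H _ kD; rewrite !big_ord_recr /= subnn e0 !mulr1.
rewrite (eq_bigr (fun i : 'I_k => nt' i.+1 * e (k.+1 - i.+1)%N)).
  by move=> /addrI.
by move=> i _; rewrite IH //; have := ltn_ord i; lia.
Qed.

End Lists.

Arguments picks : simpl never.
Arguments bumps : simpl never.
Arguments star_sum : simpl never.

(** * Formal power series and the Todd series *)

(** The type of coefficient sequences, carrying below the ring structure of
    formal power series. *)
Definition series (R : realType) := nat -> R.

Section SeriesRing.
Variable R : realType.
Implicit Types (f g h : series R).

HB.instance Definition _ := Choice.copy (series R) (nat -> R).

Definition sadd f g : series R := fun n => f n + g n.
Definition sopp f : series R := fun n => - f n.
Definition szero : series R := fun=> 0.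
Definition sone : series R := fun n => (n == 0)%:R.
Definition smul f g : series R := ps_mul f g.

Lemma saddA : associative sadd.
Proof. by move=> f g h; apply/funext => n; rewrite /sadd addrA. Qed.
Lemma saddC : commutative sadd.
Proof. by move=> f g; apply/funext => n; rewrite /sadd addrC. Qed.
Lemma sadd0 : left_id szero sadd.
Proof. by move=> f; apply/funext => n; rewrite /sadd add0r. Qed.
Lemma saddN : left_inverse szero sopp sadd.
Proof. by move=> f; apply/funext => n; rewrite /sadd /sopp addNr. Qed.

HB.instance Definition _ :=
  GRing.isZmodule.Build (series R) saddA saddC sadd0 saddN.

(** Each coefficient of a product only depends on truncations of the factors,
    so the ring axioms follow from those of polynomials. *)
Definition trunc N f : {poly R} := \poly_(i < N.+1) f i.

Lemma coef_trunc N f i : (i <= N)%N -> (trunc N f)`_i = f i.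
Proof. by move=> iN; rewrite coef_poly ltnS iN. Qed.

Lemma smul_trunc N f g n : (n <= N)%N ->
  smul f g n = (trunc N f * trunc N g)`_n.
Proof.
move=> nN; rewrite coefM; apply: eq_bigr => i _.
by rewrite !coef_trunc //; have := ltn_ord i; lia.
Qed.

Lemma smulC : commutative smul.
Proof. by move=> f g; apply/funext => n; rewrite !(smul_trunc _ _ (leqnn n)) mulrC. Qed.

Lemma smulA : associative smul.
Proof.
move=> f g h; apply/funext => n; transitivity (trunc n f * trunc n g * trunc n h)`_n.
  rewrite -mulrA coefM; apply: eq_bigr => i _.
  by rewrite coef_trunc ?(smul_trunc g h (leq_subr i n)) // -ltnS.
rewrite coefM; apply: eq_bigr => i _.
by rewrite coef_trunc ?leq_subr ?(smul_trunc f g (_ : i <= n)%N) // -ltnS.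
Qed.

Lemma smul1 : left_id sone smul.
Proof.
move=> f; apply/funext => n; rewrite /smul /ps_mul big_ord_recl /= mul1r subn0.
by rewrite big1 ?addr0 // => i _; rewrite mul0r.
Qed.

Lemma smulDl : left_distributive smul sadd.
Proof.
move=> f g h; apply/funext => n; rewrite /smul /ps_mul /sadd -big_split /=.
by apply: eq_bigr => i _; rewrite mulrDl.
Qed.

Lemma sone_neq0 : sone != 0 :> series R.
Proof.
by apply/eqP => /(congr1 (fun f : series R => f 0%N)) /eqP; rewrite oner_eq0.
Qed.

HB.instance Definition _ := GRing.Zmodule_isComNzRing.Build (series R)
  smulA smulC smul1 smulDl sone_neq0.

Lemma saddE f g n : (f + g) n = f n + g n. Proof. by []. Qed.
Lemma soppE f n : (- f) n = - f n. Proof. by []. Qed.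
Lemma soneE n : (1 : series R) n = (n == 0)%:R. Proof. by []. Qed.
Lemma smulE f g n : (f * g) n = \sum_(i < n.+1) f i * g (n - i)%N.
Proof. by []. Qed.
Lemma smulnE f k n : (f *+ k) n = f n *+ k.
Proof. by elim: k => [//|k IH]; rewrite !mulrS saddE IH. Qed.

Definition SX : series R := @ps_X R.
Definition SE : series R := @ps_one_sub_expN R.

Lemma mulSX0 f : (SX * f) 0%N = 0.
Proof. by rewrite smulE big_ord1 mul0r. Qed.

Lemma mulSXS f n : (SX * f) n.+1 = f n.
Proof.
rewrite smulE 2!big_ord_recl /= {1}/SX /ps_X mul0r add0r /bump /= mul1r.
by rewrite subSS subn0 big1 ?addr0 // => i _; rewrite mul0r.
Qed.

Lemma mulSX_inj f g : SX * f = SX * g -> f = g.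
Proof. by move=> E; apply/funext => n; rewrite -(mulSXS f) -(mulSXS g) E. Qed.

Lemma smulI f g h : f 0%N = 1 -> f * g = f * h -> g = h.
Proof.
move=> f0 E; apply/funext => n; elim/ltn_ind: n => n IH.
have := congr1 (fun u : series R => u n) E.
rewrite !smulE !big_ord_recl !subn0 f0 !mul1r.
rewrite [in X in _ = X -> _](eq_bigr (fun i : 'I_n => f (lift ord0 i) * g (n - lift ord0 i)%N)).
  by move=> /addIr.
move=> i _; congr (_ * _); apply/esym/IH.
by rewrite lift0; have := ltn_ord i; lia.
Qed.

(** The Euler operator [x d/dx]. *)
Definition euler f : series R := fun n => n%:R * f n.

Lemma eulerM f g : euler (f * g) = euler f * g + f * euler g.
Proof.
apply/funext => n; rewrite saddE !smulE /euler smulE mulr_sumr -big_split /=.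
apply: eq_bigr => i _; rewrite -{1}(subnKC (_ : i <= n)%N) -1?ltnS // natrD.
by ring.
Qed.

Lemma euler_SX : euler SX = SX.
Proof.
by apply/funext => -[|[|n]]; rewrite /euler /SX /ps_X /= ?mulr1 ?mulr0.
Qed.

(** The series of [exp (a x)]. *)
Definition expS a : series R := fun n => a ^+ n / n`!%:R.


Lemma expSD a b : expS a * expS b = expS (a + b).
Proof.
apply/funext => n; rewrite smulE /expS [a + b]addrC exprDn mulr_suml; apply: eq_bigr => i _.
have i_n : (i <= n)%N by rewrite -ltnS.
rewrite -(bin_fact i_n) !natrM -mulr_natr mulrC.
have [u v] : (i`!%:R != 0 :> R) /\ ((n - i)`!%:R != 0 :> R).
  by rewrite !pnatr_eq0 -!lt0n !fact_gt0.
have w : ('C(n, i)%:R != 0 :> R) by rewrite pnatr_eq0 -lt0n bin_gt0.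
by field; rewrite u v w.
Qed.

Lemma euler_expS a : euler (expS a) = SX * (fun n => a * expS a n).
Proof.
apply/funext => -[|n]; first by rewrite mulSX0 /euler mul0r.
rewrite mulSXS /euler /expS factS natrM exprS.
have u : (n`!%:R != 0 :> R) by rewrite pnatr_eq0 -lt0n fact_gt0.
have : n.+1%:R != 0 :> R by rewrite pnatr_eq0.
by move: n.+1%:R => v v0; field; rewrite u v0.
Qed.

Lemma SE_expS : SE = 1 - expS (-1).
Proof. by []. Qed.

Lemma euler_SE : euler SE = SX * (1 - SE).
Proof.
rewrite SE_expS subKr.
have -> : euler (1 - expS (-1)) = - euler (expS (-1)).
  apply/funext => n; rewrite soppE /euler saddE soppE soneE.
  by case: n => [|n]; rewrite ?mul0r ?oppr0 // sub0r mulrN.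
rewrite euler_expS; apply/funext => -[|n]; first by rewrite soppE !mulSX0 oppr0.
by rewrite soppE !mulSXS mulN1r opprK.
Qed.

End SeriesRing.

Arguments SX {R}.
Arguments SE {R}.

Section Todd.
Variables (R : realType) (Q : series R).
Hypothesis hQ : is_Td_half Q.

Let Q0 : Q 0%N = 1. Proof. by case: hQ. Qed.
Let QQE : Q * Q * SE = SX. Proof. by case: hQ. Qed.

(** Apply [x d/dx] to [Q^2 (1 - exp(-x)) = x] and multiply by [Q]: the factor
    [1 - exp(-x)] only occurs together with [Q^2], where it can be replaced. *)
Lemma euler_Td_half : euler Q *+ 2 = Q * (1 + SX - Q * Q).
Proof.
apply: mulSX_inj.
have H : euler (Q * Q * SE) = SX by rewrite QQE euler_SX.
rewrite !eulerM euler_SE in H.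
have {}H : Q * ((euler Q * Q + Q * euler Q) * SE + Q * Q * (SX * (1 - SE))) = Q * SX.
  by rewrite H.
have {}H : (Q * Q * SE) * euler Q *+ 2 = SX * Q - Q * (Q * Q) * SX + Q * SX * (Q * Q * SE).
  rewrite mulr2n; apply/eqP; rewrite -subr_eq0; apply/eqP.
  move/eqP: H; rewrite -subr_eq0 => /eqP H; rewrite -[RHS]H; ring.
by rewrite QQE in H; rewrite mulrnAr H; ring.
Qed.

(** So the power sums [p_k] of the formal roots of [Q], which are given by
    [x Q'/Q = p_1 x - p_2 x^2 + ...], are read off the coefficients of [Q^2];
    the square root accounts for the factor [1/2]. *)
Lemma Td_half_newton n :
  n%:R * Q n = \sum_(k < n) (1 + SX - Q * Q) k.+1 / 2 * Q (n - k.+1)%N.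
Proof.
have := congr1 (fun u : series R => u n) euler_Td_half.
rewrite [Q * _]mulrC smulnE smulE big_ord_recl /euler.
rewrite saddE soppE saddE soneE smulE big_ord1 /= Q0 mulr1 {1}/SX /ps_X /=.
rewrite addr0 subrr mul0r add0r => E.
apply: (@pmulrnI R 2) => //=; rewrite E -sumrMnl.
apply: eq_bigr => i _ /=; rewrite /bump /= add1n.
by rewrite -mulrnAl -[_ / 2 *+ 2]mulr_natr divfK // pnatr_eq0.
Qed.

(** [dilate f] is [f(x^2)]. *)
Definition dilate (f : series R) : series R :=
  fun n => if odd n then 0 else f n./2.

Lemma sum_even (F : nat -> R) m : (forall i, odd i -> F i = 0) ->
  \sum_(i < (m.*2).+1) F i = \sum_(i < m.+1) F i.*2.
Proof.
move=> F0; elim: m => [|m IH]; first by rewrite !big_ord1.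
by rewrite doubleS 2!big_ord_recr /= IH F0 /= ?odd_double // addr0 [RHS]big_ord_recr.
Qed.

Lemma dilateM f g : dilate f * dilate g = dilate (f * g).
Proof.
apply/funext => n; rewrite smulE {3}/dilate.
have [on|en] := boolP (odd n).
  rewrite big1 // => i _; rewrite /dilate oddB -1?ltnS // on.
  by case: (odd i); rewrite ?mul0r ?mulr0.
have -> : n = n./2.*2 by rewrite -[LHS](odd_double_half n) (negbTE en).
move: n./2 => {n en} m.
rewrite (@sum_even (fun i => dilate f i * dilate g (m.*2 - i)%N)); last first.
  by move=> i oi; rewrite /dilate oi mul0r.
rewrite doubleK smulE; apply: eq_bigr => i _.
by rewrite /dilate -doubleB !odd_double !doubleK.
Qed.

Lemma euler_dilate f : euler (dilate f) = dilate (euler f) *+ 2.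
Proof.
apply/funext => n; rewrite smulnE /euler /dilate.
case: ifPn => [|en]; first by rewrite mulr0 mul0rn.
rewrite -{1}(odd_double_half n) (negbTE en) add0n -muln2 natrM; ring.
Qed.

(** The hypothesis says that [Z] gives the logarithmic derivative of the series
    with coefficients [c^n / (2n+1)!], which becomes [sinh(x/2) / (x/2)] under
    the substitution of [x^2 / (4 c)]. As [exp(x/2) * (1 - exp(-x))] is
    [2 sinh(x/2)], applying [x d/dx] to logarithms yields [Q^2 - x/2 - 1]. *)
Lemma Td_sinh c (Z : nat -> R) : c != 0 ->
  (forall n, n%:R * (c ^+ n / (n.*2.+1)`!%:R) =
     \sum_(k < n) Z k.+1 * (c ^+ (n - k.+1)%N / ((n - k.+1).*2.+1)`!%:R)) ->
  forall k, (0 < k)%N -> (Q * Q) k.*2 = Z k / (4 * c) ^+ k *+ 2.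
Proof.
move=> c0 HZ.
pose z : series R := fun n => if n is 0%N then 0 else Z n / (4 * c) ^+ n.
pose s : series R := fun n => (4 ^+ n * (n.*2.+1)`!%:R)^-1.
have c4 : 4 * c != 0 by rewrite mulf_neq0 // pnatr_eq0.
have sE n : s n = (c ^+ n / (n.*2.+1)`!%:R) / (4 * c) ^+ n.
  rewrite /s exprMn !invfM.
  have : c ^+ n != 0 by rewrite expf_neq0.
  have : (4 : R) ^+ n != 0 by rewrite expf_neq0 // pnatr_eq0.
  have : (n.*2.+1)`!%:R != 0 :> R by rewrite pnatr_eq0 -lt0n fact_gt0.
  move: (c ^+ n) (4 ^+ n) (_`!%:R) => u v w w0 v0 u0.
  by field; rewrite u0 v0 w0.
have Ds : euler s = z * s.
  apply/funext => n; rewrite smulE big_ord_recl /= mul0r add0r /euler.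
  rewrite sE mulrA HZ mulr_suml; apply: eq_bigr => i _.
  rewrite sE /z /bump /= !add1n.
  have -> : (4 * c) ^+ n = (4 * c) ^+ i.+1 * (4 * c) ^+ (n - i.+1)%N.
    by rewrite -exprD subnKC.
  by rewrite invfM; ring.
pose P : series R := expS 2^-1.
have PE : P * SE = SX * dilate s.
  rewrite SE_expS mulrBr mulr1 expSD.
  apply/funext => -[|n]; first by rewrite mulSX0 saddE soppE /P /expS !expr0 subrr.
  rewrite mulSXS saddE soppE /P /expS.
  have -> : 2^-1 + -1 = - 2^-1 :> R by field.
  rewrite exprNn /dilate /=.
  have [on|en] := boolP (odd n).
    by rewrite -signr_odd /= on /= expr0 mul1r subrr.
  rewrite -signr_odd /= en /= expr1 mulN1r mulNr opprK /s.
  have -> : (n./2).*2.+1 = n.+1 by rewrite -[n in RHS]odd_double_half (negbTE en).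
  have -> : 2^-1 ^+ n.+1 = 2^-1 * (4 ^+ n./2)^-1 :> R.
    rewrite exprS -{1}[n]odd_double_half (negbTE en) add0n -mul2n exprM.
    by rewrite !exprVn -[2 ^+ 2]natrX.
  rewrite invfM -mulrDl; congr (_ * _).
  by rewrite -mulrDl -[RHS]mul1r; congr (_ * _); field.
have DP : euler P *+ 2 = SX * P.
  rewrite euler_expS; apply/funext => n.
  rewrite smulnE; case: n => [|n]; first by rewrite !mulSX0 mul0rn.
  rewrite !mulSXS /P -mulrnAl -[2^-1 *+ 2]mulr_natr.
  by rewrite mulVf ?mul1r // pnatr_eq0.
have key : Q * Q *+ 2 = SX + 2 + dilate z *+ 4.
  apply: (@smulI _ P); first by rewrite /P /expS expr0 fact0 divr1.
  apply: mulSX_inj.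
  have H : euler (P * SE) *+ 2 = euler (SX * dilate s) *+ 2 by rewrite PE.
  rewrite !eulerM euler_SE euler_SX euler_dilate Ds -dilateM in H.
  have {}H : (euler P *+ 2) * (Q * Q * SE) + (P * SX * Q * Q - P * SX * (Q * Q * SE)) *+ 2
    = (SX * dilate s) * (1 + dilate z *+ 2) * (Q * Q) *+ 2.
    transitivity (((euler P * SE + P * (SX * (1 - SE))) *+ 2) * (Q * Q)); first by ring.
    by rewrite H; ring.
  rewrite -PE DP in H.
  have {}H : SX * P * (Q * Q * SE) + (P * SX * Q * Q - P * SX * (Q * Q * SE)) *+ 2 =
     P * (1 + dilate z *+ 2) * (Q * Q * SE) *+ 2 by rewrite H; ring.
  rewrite QQE in H.
  have {}H : SX * (P * (Q * Q *+ 2)) = P * (1 + dilate z *+ 2) * SX *+ 2 + SX * P * SX.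
    by rewrite -H; ring.
  by rewrite H; ring.
move=> k k0; have := congr1 (fun u : series R => u k.*2) key.
rewrite smulnE !saddE smulnE /dilate odd_double doubleK.
have -> : SX k.*2 = 0 :> R by case: k k0.
have -> : (2 : series R) k.*2 = 0 by rewrite smulnE soneE; case: k k0 => //= *; rewrite mul0rn.
rewrite !add0r /z; case: k k0 => // k _ E.
by apply: (@pmulrnI R 2) => //=; rewrite E -mulrnA.
Qed.

End Todd.

(** * Elementary symmetric functions of cotangents *)

Section RootsToEsym.
Variable K : fieldType.
Implicit Types (ys rs : seq K).

Lemma coef_prod_1DZX ys k : (\prod_(y <- ys) (1 + y *: 'X))`_k = esym_seq ys k.
Proof.
elim: ys k => [|y ys IH] k; first by rewrite big_nil coef1.
rewrite big_cons mulrDl mul1r coefD IH -scalerAl coefZ coefXM /=.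
by case: k => [|k]; rewrite /= ?mulr0 ?IH.
Qed.

(** A polynomial with constant term [1] is the product of the [1 - x/z] over
    its roots [z]. *)
Lemma coef_esym_roots (p : {poly K}) c rs k :
  p = c *: \prod_(z <- rs) ('X - z%:P) -> p`_0 = 1 ->
  p`_k = esym_seq [seq - z^-1 | z <- rs] k.
Proof.
move=> pE p0.
have c_prod : c * \prod_(z <- rs) - z = 1.
  apply: etrans _ p0; rewrite pE coefZ -horner_coef0 horner_prod; congr (_ * _).
  by apply: eq_bigr => z _; rewrite !hornerE.
have rs0 z : z \in rs -> z != 0.
  move=> zr; apply/eqP => z0; move/eqP: c_prod; apply/negP.
  by rewrite z0 in zr; rewrite (big_rem 0) //= oppr0 mul0r mulr0 eq_sym oner_eq0.
rewrite -coef_prod_1DZX big_map; congr ((polyseq _)`_k); rewrite pE.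
transitivity ((c * \prod_(z <- rs) - z) *: \prod_(z <- rs) (1 + - z^-1 *: 'X) : {poly K}).
  rewrite -scalerA; congr (_ *: _).
  elim: rs rs0 {pE c_prod} => [|z rs IH] rs0; first by rewrite !big_nil scale1r.
  rewrite !big_cons IH => [|u ur]; last by apply: rs0; rewrite inE ur orbT.
  have -> : 'X - z%:P = - z *: (1 + - z^-1 *: 'X).
    rewrite scalerDr scalerA mulrNN divff ?rs0 ?mem_head // scale1r.
    by rewrite alg_polyC polyCN addrC.
  by rewrite -scalerAr -scalerAl scalerA mulrC.
by rewrite c_prod scale1r.
Qed.

Lemma esym_seq_scale a ys k :
  esym_seq [seq a * y | y <- ys] k = a ^+ k * esym_seq ys k.
Proof.
elim: ys k => [|y ys IH] [|k] /=; rewrite ?mulr1 ?mulr0 //.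
  by rewrite IH !addr0.
by rewrite !IH exprS; ring.
Qed.

End RootsToEsym.

Section Cotangent.
Variable R : realType.
Implicit Types (t th : R).

(** The binomial expansion of [(1 + u t)^n] with [u^k] replaced by [f k]. *)
Definition binsum (f : nat -> R) n t := \sum_(k < n.+1) 'C(n, k)%:R * f k * t ^+ k.

Lemma binsumS f n t :
  binsum f n.+1 t = binsum f n t + t * binsum (fun k => f k.+1) n t.
Proof.
rewrite /binsum big_ord_recl.
under eq_bigr => k _ do rewrite lift0 binS natrD !mulrDl.
rewrite big_split /= addrA; congr (_ + _).
  rewrite big_ord_recr /= (@bin_small n n.+1) // !mul0r addr0 [RHS]big_ord_recl !bin0.
  by congr (_ + _); apply: eq_bigr => k _; rewrite lift0.
by rewrite mulr_sumr; apply: eq_bigr => k _; rewrite exprS; ring.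
Qed.

(** The imaginary part of [i^k]; that of [i^(k+1)] is the real part of [i^k]. *)
Definition im_pow k : R := if odd k then (-1) ^+ k./2 else 0.

Lemma im_powSS k : im_pow k.+2 = - im_pow k.
Proof. by rewrite /im_pow /= negbK; case: odd; rewrite ?oppr0 // exprS mulN1r. Qed.

Lemma binsumN f n t : binsum (fun k => - f k) n t = - binsum f n t.
Proof. by rewrite /binsum -sumrN; apply: eq_bigr => k _; ring. Qed.

(** De Moivre's formula divided by [cos ^ n]. *)
Lemma de_Moivre n th : cos th != 0 ->
  sin (n%:R * th) = cos th ^+ n * binsum im_pow n (tan th) /\
  cos (n%:R * th) = cos th ^+ n * binsum (fun k => im_pow k.+1) n (tan th).
Proof.
move=> c0; elim: n => [|n [IHs IHc]].
  rewrite mul0r sin0 cos0 /binsum !big_ord1 /im_pow /= bin0 !expr0 !mulr1.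
  by rewrite !mulr0.
rewrite -natr1 mulrDl mul1r sinD cosD IHs IHc !binsumS.
have -> : binsum (fun k => im_pow k.+2) n (tan th) = - binsum im_pow n (tan th).
  by rewrite -binsumN; congr binsum; apply/funext => k; rewrite im_powSS.
rewrite exprSr /tan; split; by field.
Qed.

Lemma binsum_odd m t :
  binsum im_pow m.*2.+1 t =
  t * \sum_(j < m.+1) 'C(m.*2.+1, j.*2.+1)%:R * (- t ^+ 2) ^+ j.
Proof.
rewrite /binsum big_ord_recl {1}/im_pow mulr0 mul0r add0r.
under eq_bigr => k _ do rewrite lift0.
rewrite (@sum_even _ (fun k => 'C(m.*2.+1, k.+1)%:R *
  im_pow k.+1 * t ^+ k.+1)); last first.
  by move=> k ok; rewrite /im_pow /= ok mulr0 mul0r.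
rewrite mulr_sumr; apply: eq_bigr => j _.
rewrite /im_pow /= odd_double /= uphalf_double [(- t ^+ 2) ^+ j]exprNn [t ^+ _.*2.+1]exprS -(mul2n j) exprM; ring.
Qed.

(** The [m] angles [(k+1) pi / (2m+1)] in the open interval from [0] to [pi/2]. *)
Definition cot_angle m k : R := k.+1%:R * (pi / m.*2.+1%:R).

Lemma cot_angle_itv m k : (k < m)%N -> 0 < cot_angle m k < pi / 2.
Proof.
move=> km; have := pi_gt0 R => pi0.
rewrite mulr_gt0 ?divr_gt0 ?ltr0n //= /cot_angle mulrCA ltr_pM2l //.
rewrite ltr_pdivrMr ?ltr0n // mulrC ltr_pdivlMr // -natrM ltr_nat.
by rewrite -addnn; lia.
Qed.

Definition cot2 th : R := (tan th ^+ 2)^-1.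

(** This is [sin th < th < tan th], by the mean value theorem, together with
    [1 + cot^2 = 1 / sin^2]. *)
Lemma cot2_bounds th : 0 < th < pi / 2 -> cot2 th <= (th ^+ 2)^-1 <= cot2 th + 1.
Proof.
move=> /andP[th0 th1].
have cos_pos (x : R) : x \in `[0, th] -> 0 < cos x.
  rewrite in_itv /= => /andP[x0 xth]; apply: cos_gt0_pihalf.
  by rewrite (le_lt_trans xth) // (lt_le_trans _ x0) // oppr_lt0 divr_gt0 // pi_gt0.
have cthP : 0 < cos th by apply: cos_pos; rewrite in_itv /= lexx ltW.
have sthP : 0 < sin th by apply: sin_gt0_pihalf; rewrite th0.
have sin_le : sin th <= th.
  have dsin x : x \in `]0, th[ -> is_derive x 1 sin (cos x).
    by move=> _; exact: is_derive_sin.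
  have csin : {within `[0, th], continuous (@sin R)}%classic.
    by apply: continuous_subspaceT => x; exact: continuous_sin.
  have [c _] := MVT th0 dsin csin.
  by rewrite sin0 !subr0 => ->; rewrite (ler_piMl (ltW th0)) // cos_le1.
have tan_ge : th <= tan th.
  have dtan x : x \in `]0, th[ -> is_derive x 1 tan (cos x ^- 2).
    move=> xI; apply: is_derive_tan; rewrite gt_eqF // cos_pos //.
    exact: subset_itv_oo_cc.
  have ctan : {within `[0, th], continuous (@tan R)}%classic.
    apply: derivable_within_continuous => x xI.
    by apply: derivable_tan; rewrite gt_eqF // cos_pos.
  have [c] := MVT th0 dtan ctan.
  rewrite tan0 !subr0 => /subset_itv_oo_cc /cos_pos c0 ->.
  rewrite (ler_peMl (ltW th0)) // invf_ge1 ?exprn_gt0 //.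
have -> : cot2 th + 1 = (sin th ^+ 2)^-1.
  transitivity ((cos th ^+ 2 + sin th ^+ 2) / sin th ^+ 2).
    by rewrite /cot2 /tan; field; rewrite !gt_eqF.
  by rewrite cos2Dsin2 div1r.
have tthP := lt_le_trans th0 tan_ge.
by rewrite /cot2 !lef_pV2 ?posrE ?exprn_gt0 //
   !ler_pXn2r ?nnegrE ?(ltW th0) ?(ltW tthP) ?(ltW sthP) // tan_ge sin_le.
Qed.

(** The numbers [- tan^2 (k pi / (2m+1))] are the [m] roots of the polynomial
    obtained by dividing [sin ((2m+1) th)] by [cos^(2m+1) th * tan th] and
    writing it in terms of [- tan^2 th]. *)
Lemma esym_cot2 m k :
  esym_seq [seq cot2 (cot_angle m i) | i <- iota 0 m] k =
  'C(m.*2.+1, k.*2.+1)%:R / m.*2.+1%:R.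
Proof.
set n := m.*2.+1.
have n0 : n%:R != 0 :> R by rewrite pnatr_eq0.
pose p : {poly R} := n%:R^-1 *: \poly_(j < m.+1) 'C(n, j.*2.+1)%:R.
have pk j : p`_j = 'C(n, j.*2.+1)%:R / n%:R.
  rewrite coefZ coef_poly mulrC; case: ltnP => // mj.
  by rewrite mul0r bin_small ?mul0r // /n; lia.
pose rs : seq R := [seq - tan (cot_angle m i) ^+ 2 | i <- iota 0 m].
have itv i : i \in iota 0 m -> 0 < cot_angle m i < pi / 2.
  by rewrite mem_iota /= add0n => /cot_angle_itv.
have size_p : size p = (size rs).+1.
  rewrite size_map size_iota size_scale ?invr_neq0 // size_poly_eq //.
  by rewrite pnatr_eq0 binn.
have root_p : all (root p) rs.
  apply/allP => _ /mapP[i im ->]; have /andP[th0 th1] := itv i im.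
  have c0 : cos (cot_angle m i) != 0.
    by rewrite gt_eqF // cos_gt0_pihalf // th1 (lt_trans _ th0) // oppr_lt0
       divr_gt0 // pi_gt0.
  have s0 : sin (cot_angle m i) != 0.
    by rewrite gt_eqF // sin_gt0_pihalf // th0.
  have [+ _] := de_Moivre n c0.
  have -> : n%:R * cot_angle m i = 0 + pi *+ i.+1.
    by rewrite /cot_angle mulrCA [pi / _]mulrC mulVKf // mulr_natl add0r.
  rewrite (alternatingn (@sinDpi R)) sin0 mulr0 binsum_odd => /esym/eqP.
  have t0 : (tan (cot_angle m i) == 0) = false.
    by rewrite /tan mulf_eq0 invr_eq0 (negbTE c0) (negbTE s0).
  rewrite mulf_eq0 expf_eq0 (negbTE c0) andbF mulf_eq0 t0.
  move=> /= /eqP H; rewrite /root hornerZ horner_poly.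
  by rewrite -/n in H; rewrite H mulr0.
have uniq_rs : uniq_roots rs.
  rewrite uniq_rootsE map_inj_in_uniq ?iota_uniq // => i j im jm /oppr_inj.
  have /andP[ti0 ti1] := itv i im; have /andP[tj0 tj1] := itv j jm.
  have pi2 : - (pi / 2) < 0 :> R by rewrite oppr_lt0 divr_gt0 // pi_gt0.
  have ii : cot_angle m i \in `](- (pi / 2)), (pi / 2)[.
    by rewrite in_itv /= ti1 (lt_trans pi2).
  have jj : cot_angle m j \in `](- (pi / 2)), (pi / 2)[.
    by rewrite in_itv /= tj1 (lt_trans pi2).
  have tan_gt0 x : 0 < x -> x \in `](- (pi / 2)), (pi / 2)[ -> 0 < tan x :> R.
    move=> x0 xi; rewrite -tan0 ltr_tan //.
    by rewrite in_itv /= pi2 divr_gt0 // pi_gt0.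
  move/eqP; rewrite eqrXn2 ?ltW ?tan_gt0 // => /eqP /(tan_inj ii jj).
  rewrite /cot_angle => /(mulIf _) H.
  have /eqP : i.+1%:R = j.+1%:R :> R.
    by apply: H; rewrite mulf_neq0 ?invr_eq0 // gt_eqF // pi_gt0.
  by rewrite eqr_nat eqSS => /eqP.
have := all_roots_prod_XsubC size_p root_p uniq_rs.
move/(@coef_esym_roots _ _ _ _ k) => H.
rewrite -pk H; last by rewrite pk bin1 divff.
congr esym_seq; rewrite -map_comp; apply: eq_map => i /=.
by rewrite invrN opprK.
Qed.

End Cotangent.

(** * Even zeta values *)

Section EvenZeta.
Variable R : realType.
Local Open Scope classical_set_scope.

(** The largest index comes first, as in the zeta-star sums. *)
Fixpoint recips N : seq R :=
  if N is N'.+1 then N%:R^-1 :: recips N' else [::].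

Lemma power_sum_recips N k :
  power_sum (recips N) k = \sum_(i <- iota 0 N) (i.+1%:R^-1) ^+ k.
Proof.
elim: N => [|N IH]; first by rewrite /power_sum !big_nil.
by rewrite power_sum_cons IH -[in RHS]addn1 iotaD add0n big_cat /= big_seq1 addrC.
Qed.

Lemma cvgr_sum (T : eqType) (r : seq T) (f : T -> nat -> R) (l : T -> R) :
  (forall i, i \in r -> f i n @[n --> \oo] --> l i) ->
  (\sum_(i <- r) f i n) @[n --> \oo] --> \sum_(i <- r) l i.
Proof.
move=> H; rewrite big_seq; under eq_fun => n do rewrite big_seq.
by apply: cvg_big; [exact: add_continuous | exact: H].
Qed.

(** Newton's identities express the power sums by the elementary symmetric
    functions, so they converge as soon as the latter do. *)
Lemma power_sum_cvg (ys : nat -> seq R) (e : nat -> R) :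
  (forall k, esym_seq (ys m) k @[m --> \oo] --> e k) ->
  exists Z : nat -> R,
    (forall k, (0 < k)%N -> power_sum (ys m) k @[m --> \oo] --> Z k) /\
    forall n, n%:R * e n = \sum_(k < n) (-1) ^+ k * Z k.+1 * e (n - k.+1)%N.
Proof.
move=> He.
have cvg_p k : (0 < k)%N -> cvgn (fun m => power_sum (ys m) k).
  elim/ltn_ind: k => -[//|k] IH _.
  have -> : (fun m => power_sum (ys m) k.+1) = (fun m => (-1) ^+ k *
    (k.+1%:R * esym_seq (ys m) k.+1 -
     \sum_(i < k) (-1) ^+ i * power_sum (ys m) i.+1 * esym_seq (ys m) (k - i)%N)).
    apply/funext => m; rewrite newton big_ord_recr /= subnn esym_seq0 mulr1.
    under eq_bigr => i _ do rewrite subSS.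
    by rewrite [X in X - _]addrC addrK signrMK.
  apply: is_cvgMr; apply: is_cvgB.
    by apply: is_cvgMr; apply/cvg_ex; exists (e k.+1).
  apply/cvg_ex; exists (\sum_(i < k) (-1) ^+ i * limn (fun m => power_sum (ys m) i.+1) * e (k - i)%N).
  apply: (@cvgr_sum _ _ (fun (i : 'I_k) m =>
    (-1) ^+ i * power_sum (ys m) i.+1 * esym_seq (ys m) (k - i)%N)) => i _.
  apply: cvgM => //.
  by apply: cvgMr; apply: IH => //; rewrite ltnS.
exists (fun k => limn (fun m => power_sum (ys m) k)); split=> [k k0|n].
  exact: cvg_p.
have L : (fun m => n%:R * esym_seq (ys m) n) @ \oo --> n%:R * e n.
  exact: cvgMr.
rewrite -(cvg_lim _ L) //; apply: cvg_lim => //.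
under eq_fun => m do rewrite newton.
apply: (@cvgr_sum _ _ (fun (k : 'I_n) m => (-1) ^+ k * power_sum (ys m) k.+1 * esym_seq (ys m) (n - k.+1)%N)) => k _.
apply: cvgM => //.
by apply: cvgMr; exact: cvg_p.
Qed.

Lemma cvg_inv_odd : (m.*2.+1%:R : R)^-1 @[m --> \oo] --> (0 : R).
Proof.
apply: (@squeeze_cvgr _ _ _ _ (fun=> 0) harmonic) => //.
- near=> m; rewrite invr_ge0 ler0n /= /harmonic lef_pV2 ?posrE ?ltr0n // ler_nat.
  by rewrite -addnn; lia.
- exact: cvg_cst.
- exact: cvg_harmonic.
Unshelve. all: by end_near. Qed.

Lemma cvg_ffact_odd j :
  (m.*2.+1 ^_ j)%:R / m.*2.+1%:R ^+ j @[m --> \oo] --> (1 : R).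
Proof.
elim: j => [|j IH].
  under eq_fun => m do rewrite ffactn0 expr0 divr1.
  exact: cvg_cst.
have -> : (fun m => (m.*2.+1 ^_ j.+1)%:R / m.*2.+1%:R ^+ j.+1 : R) =
  (fun m => ((m.*2.+1 ^_ j)%:R / m.*2.+1%:R ^+ j) * ((m.*2.+1 - j)%:R / m.*2.+1%:R)).
  apply/funext => m; rewrite ffactnSr natrM exprSr invfM; ring.
rewrite -[X in _ --> X](mulr1 1); apply: cvgM => //.
apply: (@squeeze_cvgr _ _ _ _ (fun m => 1 - j%:R * (m.*2.+1%:R)^-1) (fun=> 1)).
- near=> m; apply/andP; split.
    rewrite -[X in X - _](@divff _ m.*2.+1%:R) ?pnatr_eq0 // -mulrBl.
    rewrite ler_pM2r ?invr_gt0 ?ltr0n // lerBlDr -natrD ler_nat; lia.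
  by rewrite ler_pdivrMr ?ltr0n // mul1r ler_nat leq_subr.
- rewrite -[X in _ --> X](subr0 1) -[X in _ - X](mulr0 j%:R).
  by apply: cvgB; [exact: cvg_cst | apply: cvgMr; exact: cvg_inv_odd].
- exact: cvg_cst.
Unshelve. all: by end_near. Qed.

(** The scaling makes the [k]-th entry tend to [1/k^2]. *)
Definition scaled_cot m : seq R :=
  [seq (pi / m.*2.+1%:R) ^+ 2 * cot2 (cot_angle R m i) | i <- iota 0 m].

Lemma esym_scaled_cot m k :
  esym_seq (scaled_cot m) k = (pi ^+ 2) ^+ k / (k.*2.+1)`!%:R *
    ((m.*2.+1 ^_ k.*2.+1)%:R / m.*2.+1%:R ^+ k.*2.+1).
Proof.
rewrite /scaled_cot (map_comp (fun y => (pi / m.*2.+1%:R) ^+ 2 * y)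
  (fun i => cot2 (cot_angle R m i))).
rewrite esym_seq_scale esym_cot2 -bin_ffact natrM [_ ^+ k.*2.+1]exprSr -(mul2n k) exprM !exprMn !exprVn.
have : (2 * k).+1`!%:R != 0 :> R by rewrite pnatr_eq0 -lt0n fact_gt0.
have : m.*2.+1%:R != 0 :> R by rewrite pnatr_eq0.
move: (_`!%:R) (m.*2.+1%:R) => a b b0 a0.
have bk0 : b ^+ k != 0 by rewrite expf_neq0.
by field; rewrite b0 bk0 a0.
Qed.

Lemma cvg_esym_scaled_cot k :
  esym_seq (scaled_cot m) k @[m --> \oo] --> (pi : R) ^+ 2 ^+ k / (k.*2.+1)`!%:R.
Proof.
rewrite -[X in _ --> X]mulr1; under eq_fun => m do rewrite esym_scaled_cot.
by apply: cvgMr; exact: cvg_ffact_odd.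
Qed.

(** A crude linear bound for the increment of a power: summed over the [m]
    cotangents with [u] of order [1/m^2], the error still tends to [0]. *)
Lemma expr_add_le (x u B : R) k : 0 <= x -> 0 <= u -> 1 <= B -> x + u <= B ->
  (x + u) ^+ k <= x ^+ k + u * (k%:R * B ^+ k).
Proof.
move=> x0 u0 B1 xuB; elim: k => [|k IH]; first by rewrite !expr0 mul0r mulr0 addr0.
have B0 : 0 <= B by rewrite (le_trans ler01).
have xB : x <= B by rewrite (le_trans _ xuB) // lerDl.
have Bk : 0 <= B ^+ k by rewrite exprn_ge0.
have xk : x ^+ k <= B ^+ k by rewrite lerXn2r.
have h1 : u * x ^+ k <= u * (B * B ^+ k).
  by rewrite ler_wpM2l // (le_trans xk) // ler_peMl.
have h2 : (x + u) * (u * (k%:R * B ^+ k)) <= B * (u * (k%:R * B ^+ k)).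
  by rewrite ler_wpM2r // !mulr_ge0.
have h3 := ler_wpM2l (addr_ge0 x0 u0) IH.
rewrite !exprS -natr1 (le_trans h3) // mulrDr (le_trans (lerD (lexx _) h2)) //.
move: h1; move: (x ^+ k) (B ^+ k) (k%:R) => a b c h1.
have -> : x * a + u * ((c + 1) * (B * b)) =
  (x + u) * a + B * (u * (c * b)) + (u * (B * b) - u * a) by ring.
by rewrite lerDl subr_ge0.
Qed.

(** The bounds [cot^2 <= 1/th^2 <= 1 + cot^2] hold entry by entry; the error made
    by the upper one is of order [1/m^2] in each of the [m] entries. *)
Lemma power_sum_scaled_cot_bounds m k :
  power_sum (scaled_cot m) k <= power_sum (recips m) (2 * k) <=
  power_sum (scaled_cot m) k + m.*2.+1%:R^-1 * (pi ^+ 2 * (k%:R * (1 + pi ^+ 2) ^+ k)).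
Proof.
set n : R := m.*2.+1%:R; set u : R := (pi / n) ^+ 2.
have n1 : 1 <= n by rewrite ler1n.
have n0 : 0 < n by rewrite (lt_le_trans ltr01).
have u0 : 0 <= u by rewrite sqr_ge0.
have upi : u <= pi ^+ 2.
  rewrite /u exprMn ler_piMr ?sqr_ge0 // exprVn invf_le1 ?exprn_gt0 //.
  by rewrite exprn_ege1.
have H i : i \in iota 0 m ->
  let x := u * cot2 (cot_angle R m i) in
  [/\ 0 <= x, x <= (i.+1%:R^-1) ^+ 2 & (i.+1%:R^-1) ^+ 2 <= x + u].
  rewrite mem_iota /= add0n => im.
  have := cot2_bounds (cot_angle_itv R im).
  have E : (i.+1%:R^-1) ^+ 2 = u * (cot_angle R m i ^+ 2)^-1.
    rewrite /u /cot_angle -/n.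
    have : i.+1%:R != 0 :> R by rewrite pnatr_eq0.
    have : pi / n != 0 by rewrite mulf_neq0 ?invr_eq0 ?gt_eqF ?pi_gt0.
    by move: (pi / n) (i.+1%:R) => p v p0 v0; field; rewrite v0 p0.
  move=> /andP[h1 h2]; rewrite E; split.
  - by rewrite mulr_ge0 // invr_ge0 sqr_ge0.
  - exact: ler_wpM2l.
  - by rewrite -[X in _ + X]mulr1 -mulrDr; exact: ler_wpM2l.
rewrite power_sum_recips /power_sum big_map -/n -/u; apply/andP; split.
  rewrite !big_seq; apply: ler_sum => i /H[x0 xle _].
  by rewrite exprM lerXn2r // nnegrE ?sqr_ge0.
have mn : m%:R * u <= n^-1 * pi ^+ 2.
  have E (a p : R) : 0 < a -> a^-1 * p ^+ 2 = a * (p / a) ^+ 2.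
    by move=> a0; field; rewrite gt_eqF.
  rewrite E //.
  by rewrite ler_wpM2r // ler_nat -addnn; lia.
set B : R := 1 + pi ^+ 2.
have B1 : 1 <= B by rewrite lerDl sqr_ge0.
apply: (@le_trans _ _ (\sum_(i <- iota 0 m)
   ((u * cot2 (cot_angle R m i)) ^+ k + u * (k%:R * B ^+ k)))).
  rewrite !big_seq; apply: ler_sum => i im; have [x0 xle xge] := H i im.
  rewrite exprM; apply: (le_trans (lerXn2r k _ _ xge)).
  - by rewrite nnegrE sqr_ge0.
  - by rewrite nnegrE addr_ge0.
  apply: expr_add_le => //; rewrite lerD // (le_trans xle) //.
  by rewrite exprVn invf_le1 ?exprn_gt0 ?ltr0n // exprn_ege1 // ler1n.
rewrite big_split /= lerD2l big_const_seq count_predT size_iota iter_addr_0.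
rewrite -[_ *+ m]mulr_natl [leLHS]mulrA [leRHS]mulrA.
by rewrite ler_wpM2r // mulr_ge0 // exprn_ge0 // (le_trans ler01).
Qed.

(** Euler's evaluation of the even zeta values, in the form of Newton's
    identities between them and the coefficients [pi^(2n) / (2n+1)!] of
    [sinh (pi sqrt x) / (pi sqrt x)]. *)
Lemma even_zeta : exists Z : nat -> R,
  (forall k, (0 < k)%N -> power_sum (recips N) (2 * k) @[N --> \oo] --> Z k) /\
  forall n, n%:R * ((pi ^+ 2) ^+ n / (n.*2.+1)`!%:R) =
    \sum_(k < n) (-1) ^+ k * Z k.+1 *
       ((pi ^+ 2) ^+ (n - k.+1)%N / ((n - k.+1).*2.+1)`!%:R).
Proof.
have [Z [ZP ZN]] := power_sum_cvg cvg_esym_scaled_cot.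
exists Z; split=> // k k0.
apply: (squeeze_cvgr _ (ZP k k0)).
  by near=> m; exact: power_sum_scaled_cot_bounds.
rewrite -[X in _ --> X]addr0; apply: cvgD; first exact: ZP.
rewrite -[X in _ --> X](mul0r (pi ^+ 2 * (k%:R * (1 + pi ^+ 2) ^+ k))).
by apply: cvgMl; exact: cvg_inv_odd.
Unshelve. all: by end_near. Qed.

End EvenZeta.

(** * Products of elementary symmetric functions *)

Lemma addn_tight (a b p q : nat) : (a <= p)%N -> (b <= q)%N ->
  (p + q)%N = (a + b)%N -> p = a /\ q = b.
Proof. by lia. Qed.

Lemma geq_transitive : transitive geq.
Proof. by move=> y x z /= xy yz; exact: leq_trans yz xy. Qed.

Lemma geq_antisymmetric : antisymmetric geq.
Proof. by move=> x y /=; rewrite andbC => /anti_leq. Qed.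

Section Monomials.
Variable K : comNzRingType.
Local Notation mon := {cmonom nat}.
Implicit Types (f g h : mon -> K) (m p q : mon) (l s : seq nat).

Definition facts m : {fset mon * mon} := fset_set (factorizations m).

Lemma mem_facts m (pq : mon * mon) : (pq \in facts m) = (mmul pq.1 pq.2 == m).
Proof.
rewrite in_fset_set; last exact: finite_factorizations.
by apply/idP/eqP; rewrite inE.
Qed.

(** The definitions for multivariate series are taken up over an arbitrary ring:
    the formal roots of [Q] are complex numbers. *)
Definition mmulK f g m : K := \sum_(pq <- facts m) f pq.1 * g pq.2.

Definition esymK k m : K :=
  ((mdeg m == k) && all (fun i => m i <= 1)%N (finsupp m))%:R.

Definition elemK l : mon -> K :=
  foldr (fun k f => mmulK (esymK k) f) (fun m => (mdeg m == 0%N)%:R) l.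

Arguments elemK : simpl never.

Lemma elemK_nil m : elemK [::] m = (mdeg m == 0%N)%:R. Proof. by []. Qed.

Lemma elemK_cons k l m : elemK (k :: l) m = mmulK (esymK k) (elemK l) m.
Proof. by []. Qed.

Definition prodK (q : nat -> K) m : K := \prod_(i <- finsupp m) q (m i).

Lemma prodK_widen (q : nat -> K) m (X : {fset nat}) : q 0%N = 1 ->
  (finsupp m `<=` X)%fset -> prodK q m = \prod_(i <- X) q (m i).
Proof.
move=> q0 mX; apply: (big_fset_incl _ mX) => i _.
by rewrite -cmE_eq0 => /eqP ->.
Qed.

(** Expanding a product of sums, a choice of one term for each variable of [m]
    amounts to a factorization of [m]. *)
Lemma prodKM (q r : nat -> K) m : q 0%N = 1 -> r 0%N = 1 ->
  prodK (fun n => \sum_(j < n.+1) q j * r (n - j)%N) m =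
  mmulK (prodK q) (prodK r) m.
Proof.
move=> q0 r0; pose N := mdeg m.
have le_mN i : (m i <= N)%N.
  rewrite /N mdegE; case: (boolP (i \in finsupp m)) => [im|].
    by rewrite (big_fsetD1 i im) leq_addr.
  by rewrite -cmE_eq0 => /eqP ->.
pose d (f : {ffun finsupp m -> 'I_N.+1}) : mon :=
  mkcmonom [fsfun i : finsupp m => f i : nat | 0%N].
have dE (f : {ffun finsupp m -> 'I_N.+1}) (v : finsupp m) : d f (val v) = f v.
  by rewrite /d cmE fsfun_ffun valK.
have dE0 (f : {ffun finsupp m -> 'I_N.+1}) i : i \notin finsupp m -> d f i = 0%N.
  by move=> im; rewrite /d cmE fsfun_ffun insubN.
pose ok (f : {ffun finsupp m -> 'I_N.+1}) := [forall v : finsupp m, f v <= m (val v)]%N.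
rewrite {1}/prodK big_seq_fsetE /=.
under eq_bigr => v _ do rewrite
  (big_ord_widen N.+1 (fun j => q j * r (m (val v) - j)%N)) ?ltnS ?le_mN // big_mkcond.
rewrite bigA_distr_bigA /=.
rewrite (bigID ok) /= addrC big1 ?add0r => [|f /forallPn[v fv]]; last first.
  by rewrite (bigD1 v) //= ltnS (negbTE fv) mul0r.
pose g (f : {ffun finsupp m -> 'I_N.+1}) := (d f, divcm m (d f)).
have okE (f : {ffun finsupp m -> 'I_N.+1}) : ok f -> forall i, (d f i <= m i)%N.
  move=> /forallP okf i; case: (boolP (i \in finsupp m)) => im; last by rewrite dE0.
  by rewrite (_ : i = val (FSetSub im)) // dE okf.
have dinj : injective d.
  by move=> f1 f2 E; apply/ffunP => v; apply/ord_inj; rewrite -!dE E.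
rewrite /mmulK (perm_big (map g (enum ok))); last first.
  apply: uniq_perm; first exact: fset_uniq.
    by rewrite map_inj_uniq ?enum_uniq // => f1 f2 [/dinj].
  move=> [a b]; rewrite mem_facts /=; apply/eqP/mapP => [abm|[f]].
    have mE i : m i = (a i + b i)%N by rewrite -abm cmM.
    exists [ffun v : finsupp m => inord (a (val v))].
      rewrite mem_enum; apply/forallP => v; rewrite ffunE inordK ?mE ?leq_addr //.
      by rewrite ltnS (leq_trans _ (le_mN (val v))) // mE leq_addr.
    have da : d [ffun v : finsupp m => inord (a (val v))] = a.
      apply/eqP/cmP => i; case: (boolP (i \in finsupp m)) => im; last first.
        rewrite dE0 //; move: im; rewrite -cmE_eq0 mE addn_eq0.
        by move=> /andP[/eqP ->].
      rewrite (_ : i = val (FSetSub im)) // dE ffunE inordK //=.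
      by rewrite ltnS (leq_trans _ (le_mN i)) // mE leq_addr.
    rewrite /g da; congr pair; apply/eqP/cmP => i.
    by rewrite divcmE mE addKn.
  rewrite mem_enum => /okE okf [-> ->]; apply/eqP/cmP => i.
  by rewrite cmM divcmE subnKC.
rewrite big_map big_enum /=; apply: eq_bigr => f okf.
have supp_d : (finsupp (d f) `<=` finsupp m)%fset.
  by apply/fsubsetP => i; rewrite -!cmE_neq0 -!lt0n => /leq_trans; apply; exact: okE.
have supp_m : (finsupp (divcm m (d f)) `<=` finsupp m)%fset.
  apply/fsubsetP => i; rewrite -!cmE_neq0 divcmE -!lt0n => /leq_trans; apply.
  exact: leq_subr.
rewrite (prodK_widen q0 supp_d) (prodK_widen r0 supp_m) !big_seq_fsetE /=.
rewrite -big_split /=; apply: eq_bigr => v _.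
by rewrite divcmE dE ltnS (forallP okf v).
Qed.

Lemma mmulK_neq0 f g m : mmulK f g m != 0 ->
  exists p q, [/\ mmul p q = m, f p != 0 & g q != 0].
Proof.
move=> fgm; apply: contrapT => H; move/eqP: fgm; apply.
rewrite /mmulK big_seq big1 // => -[p q]; rewrite mem_facts => /eqP /= pqm.
have [->|fp] := eqVneq (f p) 0; first by rewrite mul0r.
have [->|gq] := eqVneq (g q) 0; first by rewrite mulr0.
by case: H; exists p, q.
Qed.

Lemma eq_mmulK f g g' m : (forall p q, mmul p q = m -> g q = g' q) ->
  mmulK f g m = mmulK f g' m.
Proof.
move=> H; apply: eq_big_seq => -[p q]; rewrite mem_facts => /eqP pqm /=.
by rewrite (H p q).
Qed.

(** All monomials occurring in iterated factorizations of [m] lie in this one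
    finite set, so that sums over factorizations can be exchanged. *)
Definition divisors_fset m : seq mon := undup [seq pq.1 | pq <- facts m].

Lemma mem_divisors_fset m p :
  reflect (exists q, mmul p q = m) (p \in divisors_fset m).
Proof.
rewrite mem_undup; apply: (iffP mapP) => [[[a b]]|[q pqm]].
  by rewrite mem_facts => /eqP /= abm ->; exists b.
by exists (p, q); rewrite // mem_facts pqm /=.
Qed.

Lemma mmulK_divisors f g m q : q \in divisors_fset m ->
  mmulK f g q = \sum_(a <- divisors_fset m) \sum_(b <- divisors_fset m)
    (if mmul a b == q then f a * g b else 0).
Proof.
move=> /mem_divisors_fset[r qrm].
pose D := divisors_fset m.
transitivity (\sum_(ab <- [seq (a, b) | a <- D, b <- D])
  if mmul ab.1 ab.2 == q then f ab.1 * g ab.2 else 0); last first.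
  by rewrite big_allpairs.
rewrite -big_mkcond -big_filter /mmulK; apply: perm_big; apply: uniq_perm.
- exact: fset_uniq.
- by rewrite filter_uniq // allpairs_uniq ?undup_uniq // => -[? ?] [? ?] _ _ [-> ->].
move=> [a b]; rewrite mem_facts mem_filter /=.
case: eqP => //= abq; apply/esym/allpairsP; exists (a, b); split=> //=.
  by apply/mem_divisors_fset; exists (mmul b r); rewrite mulmA abq.
by apply/mem_divisors_fset; exists (mmul a r); rewrite mulmA [mmul b a]mulmC abq.
Qed.

Lemma mmulKCA f g h m : mmulK f (mmulK g h) m = mmulK g (mmulK f h) m.
Proof.
pose D := divisors_fset m.
have mD : m \in D by apply/mem_divisors_fset; exists mone; rewrite mulm1.
(* Both sides are the sum over the factorizations of [m] into three factors. *)
have tripleE (u v w : mon -> K) : mmulK u (mmulK v w) m =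
    \sum_(a <- D) \sum_(c <- D) \sum_(e <- D)
      (if mmul a (mmul c e) == m then u a * (v c * w e) else 0).
  rewrite (mmulK_divisors _ _ mD); apply: eq_bigr => a _.
  transitivity (\sum_(b <- D) \sum_(c <- D) \sum_(e <- D)
     (if (mmul a b == m) && (mmul c e == b) then u a * (v c * w e) else 0)).
    apply: eq_big_seq => b bD; case: eqP => abm /=; last first.
      by rewrite big1 // => c _; rewrite big1.
    rewrite (mmulK_divisors _ _ bD) mulr_sumr; apply: eq_bigr => c _.
    by rewrite mulr_sumr; apply: eq_bigr => e _; case: ifP; rewrite ?mulr0.
  rewrite exchange_big; apply: eq_bigr => c _ /=.
  rewrite exchange_big; apply: eq_bigr => e _ /=.
  case: eqP => acem.
    have ceD : mmul c e \in D.
      by apply/mem_divisors_fset; exists a; rewrite mulmC.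
    rewrite (bigD1_seq (mmul c e)) ?undup_uniq //= acem !eqxx /= big1 ?addr0 //.
    by move=> b /negbTE; rewrite eq_sym => ->; rewrite andbF.
  rewrite big1 // => b _; case: eqP => //= abm; case: eqP => // ceb.
  by case: acem; rewrite ceb.
rewrite !tripleE exchange_big; apply: eq_bigr => c _ /=.
apply: eq_bigr => a _; apply: eq_bigr => e _.
rewrite !mulmA [mmul a c]mulmC; case: eqP => // _; ring.
Qed.

Lemma elemK_cons0 l m : elemK (0%N :: l) m = elemK l m.
Proof.
rewrite elemK_cons /mmulK (bigD1_seq (mone, m)) ?fset_uniq //=; last first.
  by rewrite mem_facts /= mul1m.
rewrite /esymK mdeg1 eqxx /= mdom1 /= mul1r big_seq_cond big1 ?addr0 //.
move=> [p q]; rewrite mem_facts /= => /andP[/eqP pqm ne].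
case: eqP => [/mdeg_eq0I p1|]; last by rewrite mul0r.
by rewrite -pqm p1 mul1m eqxx in ne.
Qed.

Lemma elemK_rem a l : a \in l -> elemK l =1 elemK (a :: rem a l).
Proof.
elim: l => //= b l IH; rewrite inE eq_sym => /predU1P[->|al] m; first by rewrite eqxx.
case: eqP => [->//|_].
rewrite elemK_cons [RHS](mmulKCA (esymK a) (esymK b)).
by apply: eq_mmulK => p q _; exact: IH.
Qed.

Lemma perm_elemK l s : perm_eq l s -> elemK l =1 elemK s.
Proof.
elim: l s => [|a l IH] s ls m.
  by move: ls; rewrite perm_sym => /perm_nilP ->.
have as_ : a \in s by rewrite -(perm_mem ls) mem_head.
rewrite (elemK_rem as_) !elemK_cons; apply: eq_mmulK => p q _; apply: IH.
by rewrite -(perm_cons a) (perm_trans ls) // perm_to_rem.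
Qed.

Definition norm_part l := sort geq [seq k <- l | (0 < k)%N].

Lemma elemK_norm l : elemK l =1 elemK (norm_part l).
Proof.
move=> m; have H : perm_eq (norm_part l) [seq k <- l | (0 < k)%N].
  by rewrite perm_sort.
rewrite (perm_elemK H) {H}.
elim: l m => [//|[|k] l IH] m; first by rewrite elemK_cons0 IH.
by apply: eq_mmulK => p q _; exact: IH.
Qed.

Lemma elemK_mdeg l m : elemK l m != 0 -> mdeg m = sumn l.
Proof.
elim: l m => [|k l IH] m; first by rewrite elemK_nil; case: (mdeg m =P 0%N) => [-> //|_]; rewrite mulr0n eqxx.
move=> /mmulK_neq0[p [q [<- ep /IH eq]]]; rewrite mdegM eq /=; congr addn.
by move: ep; rewrite /esymK; case: (mdeg p =P k) => [-> //|_]; rewrite mulr0n eqxx.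
Qed.

(** The weight of a monomial for [x_i] of weight [i]. Among the monomials of
    [e_k], the one of least weight is [x_0 ... x_(k-1)], and it is the only
    one; hence also for products of elementary symmetric functions. *)
Definition mweight m : nat := \sum_(i <- finsupp m) i * m i.

Lemma mweight_widen m (X : {fset nat}) :
  (finsupp m `<=` X)%fset -> mweight m = (\sum_(i <- X) i * m i)%N.
Proof.
move=> mX; apply: (big_fset_incl _ mX) => i _.
by rewrite -cmE_eq0 => /eqP ->; rewrite muln0.
Qed.

Lemma mweightM p q : mweight (mmul p q) = (mweight p + mweight q)%N.
Proof.
rewrite (mweight_widen (fsubsetUl (finsupp p) (finsupp q))).
rewrite (mweight_widen (fsubsetUr (finsupp p) (finsupp q))).
rewrite /mweight mdomD -big_split /=; apply: eq_bigr => i _.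
by rewrite cmM mulnDr.
Qed.

(** The [i]-th entry of a strictly increasing list of numbers [>= a] is at least
    [a + i]. *)
Lemma sumn_ltn_sorted a s : sorted ltn s -> all (leq a) s ->
  (sumn (iota a (size s)) <= sumn s)%N /\
  (sumn s = sumn (iota a (size s)) -> s = iota a (size s)).
Proof.
elim: s a => [//|x s IH] a /= xs /andP[ax as_].
have a1s : all (leq a.+1) s.
  apply/allP => y ys; apply: leq_ltn_trans ax _.
  exact: (allP (order_path_min ltn_trans xs)).
have [le_s eq_s] := IH a.+1 (path_sorted xs) a1s.
split=> [|E]; first by rewrite leq_add.
have [xa E'] := addn_tight ax le_s E.
by rewrite {1}xa -eq_s.
Qed.

Definition first_vars k : mon := [cmonom 1 | i in seq_fset tt (iota 0 k)]%M.

Lemma first_varsE k i : first_vars k i = (i < k)%N.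
Proof. by rewrite cmE fsfun_fun seq_fsetE mem_iota /= add0n; case: ltnP. Qed.

Lemma finsupp_first_vars k : finsupp (first_vars k) =i iota 0 k.
Proof.
by move=> i; rewrite -cmE_neq0 first_varsE mem_iota /= add0n eqb0 negbK.
Qed.

Lemma perm_finsupp_first_vars k : perm_eq (finsupp (first_vars k)) (iota 0 k).
Proof. by rewrite uniq_perm ?fset_uniq ?iota_uniq //; exact: finsupp_first_vars. Qed.

Lemma mdeg_first_vars k : mdeg (first_vars k) = k.
Proof.
rewrite mdegE (perm_big _ (perm_finsupp_first_vars k)) big_seq.
rewrite (eq_bigr (fun=> 1%N)) => [|i]; last first.
  by rewrite mem_iota /= add0n first_varsE => ->.
by rewrite -big_seq sum1_size size_iota.
Qed.

Lemma mweight_first_vars k : mweight (first_vars k) = sumn (iota 0 k).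
Proof.
rewrite /mweight (perm_big _ (perm_finsupp_first_vars k)) sumnE.
by apply: eq_big_seq => i; rewrite mem_iota /= add0n first_varsE => ->; rewrite muln1.
Qed.

Lemma esymK_first_vars k : esymK k (first_vars k) = 1.
Proof.
rewrite /esymK mdeg_first_vars eqxx /=.
by rewrite (_ : all _ _) //; apply/allP => i _; rewrite first_varsE leq_b1.
Qed.

Lemma esymK_mweight k p : esymK k p != 0 ->
  (sumn (iota 0 k) <= mweight p)%N /\
  (mweight p = sumn (iota 0 k) -> p = first_vars k).
Proof.
rewrite /esymK; case: (mdeg p =P k) => [dp|]; last by rewrite ?andbF mulr0n eqxx.
case: allP => [sqf _|]; last by rewrite ?andbF mulr0n eqxx.
have p1 i : i \in finsupp p -> p i = 1%N.
  by move=> ip; have := sqf i ip; move: ip; rewrite -cmE_neq0; case: (p i) => [|[|]].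
pose s := sort leq (finsupp p).
have s_p : perm_eq s (finsupp p) by rewrite perm_sort.
have size_s : size s = k.
  rewrite (perm_size s_p) -dp mdegE -sum1_size; apply: eq_big_seq => i.
  by move=> /p1 ->.
have weight_s : mweight p = sumn s.
  rewrite sumnE (perm_big _ s_p) /mweight; apply: eq_big_seq => i /p1 ->.
  by rewrite muln1.
have s_sorted : sorted ltn s.
  by rewrite ltn_sorted_uniq_leq sort_uniq fset_uniq sort_sorted //; exact: leq_total.
have s_ge0 : all (leq 0) s by apply/allP.
have [le_s eq_s] := sumn_ltn_sorted s_sorted s_ge0.
rewrite size_s in le_s eq_s; rewrite weight_s; split=> // /eq_s sE.
apply/eqP/cmP => i; rewrite first_varsE.
have -> : (i < k)%N = (i \in finsupp p).
  by rewrite -(perm_mem s_p) sE mem_iota add0n.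
by case: (boolP (i \in finsupp p)) => [/p1 //|]; rewrite -cmE_eq0 => /eqP.
Qed.

Definition lowest_mon l : mon := foldr (fun k m => mmul (first_vars k) m) mone l.
Definition lowest_weight l : nat := sumn [seq sumn (iota 0 k) | k <- l].

Lemma mweight_lowest l : mweight (lowest_mon l) = lowest_weight l.
Proof.
elim: l => [|k l IH] /=; first by rewrite /mweight mdom1 big_seq_fset0.
by rewrite mweightM mweight_first_vars IH.
Qed.

Lemma mdeg_lowest l : mdeg (lowest_mon l) = sumn l.
Proof.
by elim: l => [|k l IH] /=; rewrite ?mdeg1 // mdegM mdeg_first_vars IH.
Qed.

Lemma elemK_mweight l m : elemK l m != 0 ->
  (lowest_weight l <= mweight m)%N /\
  (mweight m = lowest_weight l -> m = lowest_mon l).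
Proof.
elim: l m => [|k l IH] m.
  by rewrite elemK_nil; case: (mdeg m =P 0%N) => [/mdeg_eq0I //|_]; rewrite mulr0n eqxx.
move=> /mmulK_neq0[p [q [<- /esymK_mweight[le1 eq1] /IH[le2 eq2]]]].
rewrite mweightM /lowest_weight /= -/(lowest_weight l).
split=> [|E]; first exact: leq_add.
by have [/eq1 -> /eq2 ->] := addn_tight le1 le2 E.
Qed.

Lemma elemK_lowest l : elemK l (lowest_mon l) = 1.
Proof.
elim: l => [|k l IH]; first by rewrite elemK_nil mdeg1 eqxx.
rewrite elemK_cons /mmulK (bigD1_seq (first_vars k, lowest_mon l)) ?fset_uniq //=.
  rewrite esymK_first_vars IH mulr1 big_seq_cond big1 ?addr0 //.
  move=> [p q]; rewrite mem_facts /= => /andP[/eqP pqm ne].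
  have [->|/esymK_mweight[le1 eq1]] := eqVneq (esymK k p) 0; first by rewrite mul0r.
  have [->|/elemK_mweight[le2 eq2]] := eqVneq (elemK l q) 0; first by rewrite mulr0.
  have := congr1 mweight pqm; rewrite !mweightM mweight_first_vars mweight_lowest => E.
  have [/eq1 pE /eq2 qE] := addn_tight le1 le2 E.
  by rewrite pE qE eqxx in ne.
by rewrite mem_facts.
Qed.

Lemma lowest_monE l i : lowest_mon l i = count (ltn i) l.
Proof.
by elim: l => [|k l IH] /=; rewrite ?cm1 // cmM first_varsE IH.
Qed.

(** The exponents of the lowest monomial are the parts of the conjugate
    partition. *)
Lemma lowest_mon_inj l s : is_partition l -> is_partition s ->
  lowest_mon l = lowest_mon s -> l = s.
Proof.
move=> /andP[sl l0] /andP[ss s0] E.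
apply: (sorted_eq _ _ sl ss); [exact: geq_transitive | exact: geq_antisymmetric |].
apply/allP => -[|i] _ /=.
  have H u : all (ltn 0%N) u -> count_mem 0%N u = 0%N.
    by move=> u0; apply/count_memPn/negP => /(allP u0).
  by rewrite !H.
have H u : count (ltn i) u = (count_mem i.+1 u + count (ltn i.+1) u)%N.
  elim: u => [//|x u IHu] /=; rewrite IHu.
  have -> : (i < x)%N = ((x == i.+1) + (i.+1 < x))%N :> nat by lia.
  by rewrite -!addnA; congr addn; rewrite addnCA.
have := congr1 (fun m : mon => m i) E; rewrite !lowest_monE !H => E1.
have := congr1 (fun m : mon => m i.+1) E; rewrite !lowest_monE => E2.
by apply/eqP; move: E1; rewrite E2 => /addIn.
Qed.

(** The products of elementary symmetric functions are linearly independent,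
    being triangular with respect to the weight of their lowest monomials. *)
Lemma elemK_free n (P : seq (seq nat)) (d : seq nat -> K) :
  uniq P -> all is_partition P -> all (fun l => sumn l == n) P ->
  (forall m, mdeg m = n -> \sum_(l <- P) d l * elemK l m = 0) ->
  {in P, forall l, d l = 0}.
Proof.
move=> uP partP sumP H l.
have [w] := ubnP (lowest_weight l); elim: w l => // w IH l lw lP.
(* At the lowest monomial of [l], the only other contributions are from products
   of smaller lowest weight, whose coefficients vanish by induction. *)
have := H _ (etrans (mdeg_lowest l) (eqP (allP sumP l lP))).
rewrite (bigD1_seq l) //= elemK_lowest mulr1 big_seq_cond big1 ?addr0 //.
move=> s /andP[sP sl].
have [->|/elemK_mweight[le eq]] := eqVneq (elemK s (lowest_mon l)) 0.
  by rewrite mulr0.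
rewrite mweight_lowest in le eq.
move: le; rewrite leq_eqVlt => /predU1P[E|lt]; last first.
  by rewrite IH ?mul0r // (leq_trans lt).
by rewrite (lowest_mon_inj (allP partP l lP) (allP partP s sP)) ?eqxx ?eq in sl *.
Qed.

End Monomials.

Arguments elemK : simpl never.

(** * The dual Cauchy identity *)

Lemma perm_sort_geq (s t : seq nat) : perm_eq s t -> sort geq s = sort geq t.
Proof.
move=> st; apply/perm_sortP => //; first by move=> x y; rewrite /= leq_total.
  exact: geq_transitive.
exact: geq_antisymmetric.
Qed.

Section Cauchy.
Variable K : comNzRingType.
Local Notation mon := {cmonom nat}.
Implicit Types (y : K) (ys : seq K) (m p q : mon) (l s : seq nat).

(** The exponent vectors of length [n] with entries at most [D]. *)
Definition exponents D n : seq (seq nat) :=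
  iter n (fun A => [seq k :: s | k <- iota 0 D.+1, s <- A]) [:: [::]].

Lemma exponentsS D n : exponents D n.+1 =
  [seq k :: s | k <- iota 0 D.+1, s <- exponents D n].
Proof. by []. Qed.

Lemma mem_exponents D n s :
  (s \in exponents D n) = (size s == n) && all (leq^~ D) s.
Proof.
elim: n s => [|n IH] s; first by case: s.
rewrite exponentsS; case: s => [|k s].
  by apply/negP => /allpairsP[[? ?] []].
rewrite [size _]/= [all _ _]/= eqSS; apply/allpairsP/and3P => [[[j u] [jD uA [-> ->]]]|[sn kD sD]].
  rewrite IH in uA; have /andP[? ?] := uA; split=> //.
  by move: jD; rewrite mem_iota.
by exists (k, s); rewrite IH sn sD mem_iota.
Qed.

Fixpoint monomial ys s : K :=
  match ys, s with
  | y :: ys', k :: s' => y ^+ k * monomial ys' s'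
  | _, _ => 1
  end.

Lemma sum_exponents_cons (V : nmodType) (F : seq nat -> V) D n :
  \sum_(s <- exponents D n.+1) F s =
  \sum_(k <- iota 0 D.+1) \sum_(s <- exponents D n) F (k :: s).
Proof. exact: big_allpairs_dep. Qed.

(** The product of the [1 + y x_i] is the generating series of the elementary
    symmetric functions. *)
Lemma prodK_1DX y p D : (mdeg p <= D)%N ->
  prodK (fun n => if n is n'.+1 then (if n' is 0 then y else 0) else 1) p =
  \sum_(k <- iota 0 D.+1) y ^+ k * esymK K k p.
Proof.
move=> pD; rewrite (bigD1_seq (mdeg p)) ?iota_uniq ?mem_iota //=.
rewrite [X in _ + X]big1 ?addr0 => [|k /negbTE kp]; last first.
  by rewrite /esymK eq_sym kp mulr0.
rewrite /esymK eqxx /=; case: allP => [sqf|/allP/allPn[i ip pi]]; last first.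
  rewrite mulr0 /prodK (bigD1_seq i) ?fset_uniq //=.
  by case: (p i) pi => [|[|n]] //; rewrite mul0r.
rewrite mulr1 mdegE -prodrXr /prodK; apply: eq_big_seq => i ip.
by have := sqf i ip; move: ip; rewrite -cmE_neq0; case: (p i) => [|[|]].
Qed.

(** The dual Cauchy identity. The product of the [1 + y_j x_i] over all [i] and
    [j] is the product over [i] of the series with coefficients [e_k(y)], and
    over [j] that of the series [1 + y_j e_1(x) + y_j^2 e_2(x) + ...]. *)
Lemma cauchy ys D m : (mdeg m <= D)%N ->
  prodK (esym_seq ys) m =
  \sum_(s <- exponents D (size ys)) monomial ys s * elemK K s m.
Proof.
elim: ys m => [|y ys IH] m mD.
  rewrite /= big_seq1 mul1r elemK_nil /prodK.
  case: (mdeg m =P 0%N) => [/mdeg_eq0I ->|m0]; first by rewrite mdom1 big_seq_fset0.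
  have /fset0Pn[i im] : finsupp m != fset0.
    by apply/eqP => m0'; apply: m0; rewrite mdegE m0' big_seq_fset0.
  rewrite (bigD1_seq i) ?fset_uniq //=.
  by move: im; rewrite -cmE_neq0 => /negbTE ->; rewrite mul0r.
rewrite sum_exponents_cons.
pose q (n : nat) : K := if n is n'.+1 then (if n' is 0 then y else 0) else 1.
have -> : esym_seq (y :: ys) = fun n => \sum_(j < n.+1) q j * esym_seq ys (n - j)%N.
  apply/funext => -[|n]; first by rewrite big_ord1 /= subnn mul1r addr0.
  rewrite 2!big_ord_recl /= mul1r subn0 subn1 /= big1 ?addr0 //.
  by move=> i _; rewrite /= mul0r.
rewrite prodKM ?esym_seq0 // /mmulK.
rewrite (eq_big_seq (fun ab : mon * mon => \sum_(k <- iota 0 D.+1)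
  y ^+ k * esymK K k ab.1 *
  \sum_(s <- exponents D (size ys)) monomial ys s * elemK K s ab.2)); last first.
  move=> [a b]; rewrite mem_facts => /eqP /= abm.
  have aD : (mdeg a <= D)%N by rewrite (leq_trans _ mD) // -abm mdegM leq_addr.
  have bD : (mdeg b <= D)%N by rewrite (leq_trans _ mD) // -abm mdegM leq_addl.
  by rewrite (prodK_1DX y aD) (IH b bD) mulr_suml.
rewrite exchange_big; apply: eq_bigr => k _.
under eq_bigr => ab _ do rewrite mulr_sumr.
rewrite exchange_big; apply: eq_bigr => s _ /=.
rewrite elemK_cons /mmulK mulr_sumr; apply: eq_bigr => ab _; ring.
Qed.

(** The monomial symmetric function [m_l(y)], provided that no part of [l]
    exceeds [D]. *)
Definition mono_sym D ys l : K :=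
  \sum_(s <- exponents D (size ys) | perm_eq [seq k <- s | (0 < k)%N] l)
    monomial ys s.

Lemma mono_sym_perm D ys l s : perm_eq l s -> mono_sym D ys l = mono_sym D ys s.
Proof. by move=> ls; apply: eq_bigl => u; rewrite (permPr ls). Qed.

Lemma perm_cons_rem (k : nat) s l :
  perm_eq (k :: s) l = (k \in l) && perm_eq s (rem k l).
Proof.
have [kl|kl] /= := boolP (k \in l).
  by rewrite (permPr (perm_to_rem kl)) perm_cons.
by apply/negP => /perm_mem/(_ k); rewrite mem_head (negbTE kl).
Qed.

Lemma mono_sym_cons D y ys l : all (ltn 0%N) l -> all (leq^~ D) l ->
  mono_sym D (y :: ys) l =
  mono_sym D ys l + \sum_(a <- undup l) y ^+ a * mono_sym D ys (rem a l).
Proof.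
move=> l0 lD; rewrite /mono_sym /= big_mkcond sum_exponents_cons /=.
rewrite big_cons /=; congr (_ + _).
  by rewrite -big_mkcond /=; apply: eq_bigr => s _; rewrite mul1r.
have -> : \sum_(a <- undup l) y ^+ a * mono_sym D ys (rem a l) =
   \sum_(a <- iota 1 D | a \in l) y ^+ a * mono_sym D ys (rem a l).
  rewrite -[RHS]big_filter; apply: perm_big; apply: uniq_perm.
  - exact: undup_uniq.
  - by rewrite filter_uniq // iota_uniq.
  move=> a; rewrite mem_undup mem_filter mem_iota andbC.
  case: (boolP (a \in l)) => al; rewrite ?andbF //=.
  have /= a0 := allP l0 a al; have /= aD := allP lD a al.
  by rewrite add1n ltnS a0 aD.
rewrite [RHS]big_mkcond; apply: eq_big_seq => k; rewrite mem_iota => /andP[k0 _].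
rewrite -big_mkcond /= k0; case: ifP => kl.
  rewrite mulr_sumr; apply: eq_bigl => s.
  by rewrite perm_cons_rem kl.
by rewrite big_pred0 // => s; rewrite perm_cons_rem kl.
Qed.

Definition mult_fact l : nat := \prod_(i <- undup l) (count_mem i l)`!.

Lemma mult_fact_widen l s : uniq s -> {subset l <= s} ->
  mult_fact l = (\prod_(i <- s) (count_mem i l)`!)%N.
Proof.
move=> us ls; rewrite /mult_fact [RHS](bigID (mem l)) /= [X in (_ * X)%N]big1 => [|i il]; last first.
  by rewrite (count_memPn il).
rewrite muln1 -[RHS]big_filter; apply: perm_big; apply: uniq_perm.
- exact: undup_uniq.
- exact: filter_uniq.
by move=> i; rewrite mem_undup mem_filter; case: (boolP (i \in l)) => // /ls ->.
Qed.

Lemma mult_fact_perm l s : perm_eq l s -> mult_fact l = mult_fact s.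
Proof.
move=> ls; rewrite (@mult_fact_widen l (undup s)) ?undup_uniq //.
  by apply: eq_bigr => i _; rewrite (seq.permP ls).
by move=> i; rewrite mem_undup (perm_mem ls).
Qed.

Lemma mult_fact_rem a l : a \in l ->
  mult_fact l = (count_mem a l * mult_fact (rem a l))%N.
Proof.
move=> al; rewrite (mult_fact_widen (undup_uniq l) (l := rem a l)); last first.
- by move=> i /mem_rem; rewrite mem_undup.
have au : a \in undup l by rewrite mem_undup.
rewrite /mult_fact !(bigD1_seq a au (undup_uniq _)) /= mulnA; congr muln.
  rewrite (seq.permP (perm_to_rem al)) /= eqxx add1n factS; congr (_ * _)%N.
apply: eq_bigr => i ia; congr factorial.
by rewrite (seq.permP (perm_to_rem al)) /= eq_sym (negbTE ia).
Qed.

(** Permuting equal parts, each monomial of [m_l] arises from as many injections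
    of the parts into the variables as [mult_fact l] says. The recursions on
    the variables agree: distinct values of the first exponent on one side,
    positions on the other. *)
Lemma mult_fact_mono_sym D ys l : all (ltn 0%N) l -> all (leq^~ D) l ->
  (mult_fact l)%:R * mono_sym D ys l = aug_monomial ys l.
Proof.
elim: ys l => [|y ys IH] l l0 lD.
  rewrite /mono_sym /= big_mkcond big_seq1 /=.
  case: l {l0 lD} => [|a l]; first by rewrite /mult_fact big_nil mulr1.
  by case: ifP => [/perm_size|_] //; rewrite mulr0.
rewrite mono_sym_cons // mulrDr IH //=; congr (_ + _).
have -> : \sum_(p <- picks l) y ^+ p.1 * aug_monomial ys p.2 =
   \sum_(p <- picks l) y ^+ p.1 * (mult_fact (rem p.1 l))%:R * mono_sym D ys (rem p.1 l).
  apply: eq_big_seq => -[a s] /perm_picks /= als.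
  have al : a \in l by rewrite (perm_mem als) mem_head.
  have srem : perm_eq s (rem a l).
    by rewrite -(perm_cons a) -(permPl als) perm_to_rem.
  have sub : {subset s <= l} by move=> i is_; rewrite (perm_mem als) inE is_ orbT.
  rewrite -mulrA -(mult_fact_perm srem) -(mono_sym_perm _ _ srem) IH //.
    by apply/allP => i /sub; exact: (allP l0).
  by apply/allP => i /sub; exact: (allP lD).
rewrite (sum_picks_fst (fun a => y ^+ a * (mult_fact (rem a l))%:R * mono_sym D ys (rem a l))).
rewrite -[RHS]big_undup_iterop_count /= mulr_sumr; apply: eq_big_seq => a.
rewrite mem_undup => al; rewrite (mult_fact_rem al) natrM.
have -> (x : K) n : iterop n +%R x 0 = x *+ n by [].
rewrite -mulr_natl; ring.
Qed.

(** Every partition of [n], padded by zeros, is an exponent vector of length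
    [n] with entries at most [n]. *)
Definition partitions n : seq (seq nat) :=
  undup [seq norm_part s | s <- exponents n n & sumn s == n].

Lemma sumn_norm_part s : sumn (norm_part s) = sumn s.
Proof.
rewrite (perm_sumn (_ : perm_eq _ [seq k <- s | (0 < k)%N])) ?perm_sort //.
by elim: s => [//|[|k] s IH] /=; rewrite IH.
Qed.

Lemma norm_partP s : is_partition (norm_part s).
Proof.
rewrite /is_partition all_sort filter_all andbT sort_sorted //.

Qed.

Lemma norm_part_id l : is_partition l -> norm_part l = l.
Proof.
move=> /andP[sl l0]; rewrite /norm_part (all_filterP l0).
by apply: sorted_sort => //; exact: geq_transitive.
Qed.

Lemma mem_partitions n l : (l \in partitions n) = is_partition l && (sumn l == n).
Proof.
rewrite mem_undup; apply/mapP/andP => [[s]|[lP /eqP ln]].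
  by rewrite mem_filter => /andP[sn _] ->; rewrite norm_partP sumn_norm_part.
have /andP[_ l0] := lP.
have size_l : (size l <= n)%N.
  by rewrite -ln; elim: l l0 {lP ln} => //= a l IH /andP[a0 /IH]; lia.
exists (l ++ nseq (n - size l) 0%N).
  rewrite mem_filter sumn_cat sumn_nseq mul0n addn0 ln eqxx /=.
  rewrite mem_exponents size_cat size_nseq subnKC // eqxx all_cat all_nseq orbT andbT.
  apply/allP => a al; rewrite -ln.
  by rewrite (perm_sumn (perm_to_rem al)) /= leq_addr.
rewrite /norm_part filter_cat (_ : [seq k <- nseq _ _ | _] = [::]) ?cats0.
  by rewrite -/(norm_part l) norm_part_id.
by elim: (n - size l)%N.
Qed.

(** The exponent vectors are grouped by the partition that they sort to, on
    which alone the product of elementary symmetric functions depends. *)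
Lemma cauchy_mono_sym ys m n : mdeg m = n ->
  prodK (esym_seq ys) m =
  \sum_(l <- partitions n) mono_sym n ys l * elemK K l m.
Proof.
move=> mn; rewrite (@cauchy ys n) ?mn //.
under [RHS]eq_bigr => l _ do rewrite /mono_sym mulr_suml big_mkcond.
rewrite exchange_big /=; apply: eq_bigr => s _.
have normP l : is_partition l ->
    perm_eq [seq k <- s | (0 < k)%N] l = (l == norm_part s).
  move=> lP; apply/idP/eqP => [sl|->]; last by rewrite perm_sym perm_sort.
  rewrite -[LHS]norm_part_id //; apply/esym/perm_sort_geq.
  by rewrite (perm_trans sl) // perm_sym; have /andP[_ /all_filterP ->] := lP.
transitivity (\sum_(l <- partitions n)
    (if l == norm_part s then monomial ys s * elemK K s m else 0)); last first.
  apply: eq_big_seq => l; rewrite mem_partitions => /andP[lP _].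
  by rewrite normP //; case: eqP => // ->; rewrite -elemK_norm.
rewrite -big_mkcond; have [sP|sP] := boolP (norm_part s \in partitions n).
  by rewrite -big_filter filter_pred1_uniq ?undup_uniq // big_seq1.
rewrite big_seq_cond big_pred0 => [|l]; last first.
  by apply/andP => -[lP /eqP E]; rewrite -E lP in sP.
suff -> : elemK K s m = 0 by rewrite mulr0.
apply/eqP; apply: contraNT sP => /elemK_mdeg E.
by rewrite mem_partitions norm_partP sumn_norm_part -E mn eqxx.
Qed.

End Cauchy.

(** * Coefficients of a genus *)

Section GenusCoefficients.
Variable R : realType.
Local Notation mon := {cmonom nat}.

Lemma mps_mulE (f g : mon -> R) : mps_mul f g = mmulK f g.
Proof.
apply/funext => m; rewrite /mps_mul /mmulK fsbig_finite //.
exact: finite_factorizations.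
Qed.

Lemma elem_partE l : elem_part R l = elemK R l.
Proof. by elim: l => [//|k l IH]; rewrite /= IH mps_mulE. Qed.

Lemma rmorph_elemK (K : comNzRingType) (phi : {rmorphism R -> K}) l m :
  phi (elemK R l m) = elemK K l m.
Proof.
elim: l m => [|k l IH] m; first by rewrite !elemK_nil rmorph_nat.
rewrite !elemK_cons /mmulK rmorph_sum; apply: eq_bigr => ab _.
by rewrite rmorphM IH rmorph_nat.
Qed.

(** By homogeneity only the partitions of [mdeg m] contribute at [m]. *)
Lemma genus_sum_partitions (b : seq nat -> R) m :
  (\sum_(l \in [set l | is_partition l]%classic) b l * elem_part R l m =
  \sum_(l <- partitions (mdeg m)) b l * elemK R l m).
Proof.
under eq_fsbigr => l _ do rewrite elem_partE.
rewrite [RHS]fsbig_seq ?undup_uniq //; apply/esym/fsbig_widen.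
- by move=> l /=; rewrite mem_partitions => /andP[].
move=> l [/= lP nl]; have [->|/elemK_mdeg E] := eqVneq (elemK R l m) 0.
  by rewrite mulr0.
by case: nl; rewrite mem_partitions lP E eqxx.
Qed.

(** By the dual Cauchy identity the monomial symmetric functions of the formal
    roots of [Q] satisfy the equations that define the coefficients [b l], and
    these have only one solution. Only the coefficients of [Q] up to the weight
    of [l] matter, so finitely many roots are enough. *)
Lemma genus_coef_aug_monomial (Q : nat -> R) (b : seq nat -> R)
    (K : comNzRingType) (phi : {rmorphism R -> K}) (ys : seq K) l :
  is_genus_coef Q b -> is_partition l ->
  (forall k, (k <= sumn l)%N -> phi (Q k) = esym_seq ys k) ->
  phi (b l) * (mult_fact l)%:R = aug_monomial ys l.
Proof.
move=> [_ hb] lP hQ; set n := sumn l in hQ.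
have free : {in partitions n, forall s, phi (b s) - mono_sym n ys s = 0}.
  apply: (@elemK_free _ n); first exact: undup_uniq.
  - by apply/allP => s; rewrite mem_partitions => /andP[].
  - by apply/allP => s; rewrite mem_partitions => /andP[].
  move=> m mn; under eq_bigr => s _ do rewrite mulrBl.
  rewrite sumrB -(cauchy_mono_sym ys mn) -(_ : phi (prod_series Q m) = \sum_(s <- _) _).
    rewrite /prod_series rmorph_prod /prodK; apply/eqP; rewrite subr_eq0; apply/eqP.
    apply: eq_big_seq => i im; rewrite hQ // -mn mdegE (big_fsetD1 i im).
    exact: leq_addr.
  rewrite hb genus_sum_partitions mn rmorph_sum; apply: eq_bigr => s _.
  by rewrite rmorphM rmorph_elemK.
have lP' : l \in partitions n by rewrite mem_partitions lP eqxx.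
have /eqP := free l lP'; rewrite subr_eq0 => /eqP ->.
have /andP[_ l0] := lP.
rewrite mulrC mult_fact_mono_sym //; apply/allP => a al /=.
by rewrite /n (perm_sumn (perm_to_rem al)) /= leq_addr.
Qed.

End GenusCoefficients.

(** * Zeta-star series as limits *)

Section StarSeries.
Variable R : realType.
Local Open Scope classical_set_scope.

(** The weakly decreasing sequences of length [r] with entries in [1, N]. *)
Fixpoint decr_seqs N r : seq (seq nat) :=
  if r is r'.+1 then
    (fix loop N := if N is N'.+1 then
       loop N' ++ [seq N :: s | s <- decr_seqs N r'] else [::]) N
  else [:: [::]].

Arguments decr_seqs : simpl never.

Lemma decr_seqsSS N r :
  decr_seqs N.+1 r.+1 = decr_seqs N r.+1 ++ [seq N.+1 :: s | s <- decr_seqs N.+1 r].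
Proof. by []. Qed.

Lemma mem_decr_seqs N r s : (s \in decr_seqs N r) =
  [&& size s == r, path geq N s & all (ltn 0%N) s].
Proof.
elim: r N s => [|r IHr] N s.
  by case: s.
elim: N s => [|N IHN] s.
  case: s => [|[|a] s]; rewrite //= ?andbF //.
rewrite decr_seqsSS mem_cat IHN.
case: s => [|a s].
  by rewrite andFb orFb; apply/negP => /mapP[].
rewrite /= eqSS; case: (ltngtP a N.+1) => aN.
- rewrite -ltnS aN /=; case: mapP => [[u _ [E]]|_]; last by rewrite orbF.
  by rewrite E ltnn in aN.
- rewrite leqNgt ltnW //= !andbF; apply/negP => /mapP[u _ [E]].
  by rewrite E ltnn in aN.
rewrite aN ltnn andbF /= -IHr mem_map // => u v [].
done.
Qed.

Lemma decr_seqs_uniq N r : uniq (decr_seqs N r).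
Proof.
elim: r N => [//|r IHr] N; elim: N => [//|N IHN].
rewrite decr_seqsSS cat_uniq IHN map_inj_uniq ?IHr /=; last by move=> u v [].
rewrite andbT; apply/hasPn => _ /mapP[u _ ->].
by rewrite mem_decr_seqs /= ltnn !andbF.
Qed.

Lemma decr_seqs0 N : decr_seqs N 0 = [:: [::]]. Proof. by case: N. Qed.

Lemma star_sum_decr_seqs N (t : seq nat) :
  star_sum (recips R N) t =
  \sum_(s <- decr_seqs N (size t)) \prod_(p <- zip s t) (p.1%:R^-1) ^+ p.2.
Proof.
elim: t N => [|k t IHt] N.
  by rewrite star_sum0 decr_seqs0 big_seq1 big_nil.
elim: N => [|N IHN]; first by rewrite star_sum_nil big_nil.
rewrite [size _]/= decr_seqsSS big_cat big_map /= star_sum_cons -IHN.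
congr (_ + _); rewrite -/(recips R N.+1) IHt mulr_sumr.
by apply: eq_bigr => s _; rewrite big_cons.
Qed.

Definition ffun_of_seq r (s : seq nat) : {ffun 'I_r -> nat} :=
  [ffun i : 'I_r => nth 0%N s i].

Lemma ffun_of_seq_inj r : {in [pred s | size s == r] &, injective (@ffun_of_seq r)}.
Proof.
move=> s u /eqP sr /eqP ur /ffunP E; apply: (@eq_from_nth _ 0%N); first by rewrite sr ur.
by move=> i; rewrite sr => ir; have := E (Ordinal ir); rewrite !ffunE.
Qed.

Lemma star_indices_decr r (n : {ffun 'I_r -> nat}) N :
  star_indices n -> (forall i, (n i <= N)%N) ->
  exists2 s, s \in decr_seqs N r & n = ffun_of_seq r s.
Proof.
move=> [n0 nd] nN; exists [seq n i | i <- enum 'I_r].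
  rewrite mem_decr_seqs size_map size_enum_ord eqxx /=; apply/andP; split.
    rewrite path_sortedE; last by move=> y x z /= xy yz; exact: leq_trans yz xy.
    apply/andP; split; first by apply/allP => _ /mapP[i _ ->] /=.
    rewrite sorted_map; apply: (@sub_sorted _ (relpre val ltn)).
      by move=> i j /= /ltnW; exact: nd.
    by rewrite -sorted_map val_enum_ord iota_ltn_sorted.
  by apply/allP => _ /mapP[i _ ->] /=.
by apply/ffunP => i; rewrite ffunE (nth_map i) ?size_enum_ord // nth_ord_enum.
Qed.

Lemma decr_seqs_star_indices N r s : s \in decr_seqs N r ->
  star_indices (ffun_of_seq r s).
Proof.
rewrite mem_decr_seqs => /and3P[/eqP sr sN s0].
split=> [i|i j ij]; rewrite !ffunE.
  by apply: (allP s0); rewrite mem_nth // sr.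
have geq_refl : reflexive geq by move=> x /=.
apply: (@sorted_leq_nth _ geq _ geq_refl 0%N s (path_sorted sN) i j);
  rewrite ?inE ?sr //.
by move=> y x z /= xy yz; exact: leq_trans yz xy.
Qed.

Lemma prod_zip_nth r (s t : seq nat) : size s = r -> size t = r ->
  \prod_(p <- zip s t) (p.1%:R^-1 : R) ^+ p.2 =
  \prod_(i < r) ((nth 0%N s i)%:R^-1) ^+ nth 0%N t i.
Proof.
move=> sr tr; rewrite (big_nth (0, 0)%N) size_zip sr tr minnn big_mkord.
by apply: eq_bigr => i _; rewrite nth_zip ?sr ?tr.
Qed.

Lemma star_sum_ge0 N t : 0 <= star_sum (recips R N) t.
Proof.
rewrite star_sum_decr_seqs sumr_ge0 // => s _; apply: prodr_ge0 => p _.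
by rewrite exprn_ge0 // invr_ge0.
Qed.

Lemma star_sum_mono t : nondecreasing_seq (fun N => star_sum (recips R N) t).
Proof.
apply/nondecreasing_seqP => N; case: t => [|k t]; first by rewrite !star_sum0.
rewrite [X in _ <= X]star_sum_cons lerDl mulr_ge0 //.
exact: (star_sum_ge0 N.+1).
Qed.

Lemma star_sum1 t : star_sum (recips R 1) t = 1.
Proof.
elim: t => [//|k t IH]; rewrite /= star_sum_cons star_sum_nil add0r.
by rewrite -/(recips R 1) IH invr1 expr1n mulr1.
Qed.

(** The series has positive terms and every finite set of indices is contained
    in a truncation, so that the sum is the supremum of the truncations. *)
Lemma zeta_star_lim r (t : seq nat) : size t = r ->
  (star_sum (recips R N) t)%:E @[N --> \oo] -->
  zeta_star (fun i : 'I_r => (nth 0%N t i)%:R : R).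
Proof.
move=> tr.
have FE (n : {ffun 'I_r -> nat}) :
    (\prod_(i < r) ((n i)%:R `^ (nth 0%N t i)%:R))^-1 =
    \prod_(i < r) ((n i)%:R^-1 : R) ^+ nth 0%N t i.
  rewrite -prodfV; apply: eq_bigr => i _.
  by rewrite powR_mulrn // exprVn.
have F0 (n : {ffun 'I_r -> nat}) :
    (0 <= ((\prod_(i < r) ((n i)%:R `^ (nth 0%N t i)%:R))^-1 : R)%:E)%E.
  by rewrite lee_fin FE; apply: prodr_ge0 => i _; rewrite exprn_ge0 // invr_ge0.
have sumE N : (star_sum (recips R N) t)%:E =
    (\sum_(n <- [seq ffun_of_seq r s | s <- decr_seqs N r])
       ((\prod_(i < r) ((n i)%:R `^ (nth 0%N t i)%:R))^-1)%:E)%E.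
  rewrite big_map sumEFin star_sum_decr_seqs tr; congr (_%:E).
  apply: eq_big_seq => s; rewrite mem_decr_seqs => /and3P[/eqP sr _ _].
  rewrite (prod_zip_nth sr tr) FE; apply: eq_bigr => i _.
  by rewrite ffunE.
have uniq_seqs N : uniq [seq ffun_of_seq r s | s <- decr_seqs N r].
  rewrite map_inj_in_uniq ?decr_seqs_uniq // => s u.
  rewrite !mem_decr_seqs => /and3P[sr _ _] /and3P[ur _ _].
  exact: ffun_of_seq_inj.
have -> : zeta_star (fun i : 'I_r => (nth 0%N t i)%:R : R) =
    ereal_sup (range (fun N => (star_sum (recips R N) t)%:E)).
  apply/eqP; rewrite eq_le; apply/andP; split.
    apply: ub_ereal_sup => _ [X [finX XI] <-].
    have [N HN] : exists N, forall n, X n -> forall i, (n i <= N)%N.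
      exists (\max_(n <- fset_set X) \max_(i < r) n i)%N => n Xn i.
      have nX : n \in fset_set X by rewrite in_fset_set // inE.
      apply: (@leq_trans (\max_(i < r) n i)%N); first exact: leq_bigmax.
      exact: (leq_bigmax_seq (F := fun u : {ffun 'I_r -> nat} => \max_(i < r) u i)%N).
    apply: (@le_trans _ _ (star_sum (recips R N) t)%:E).
      2: by apply: ereal_sup_ubound; exists N.
    rewrite sumE (fsbig_seq _ _ (uniq_seqs N)).
    apply: lee_fsum_nneg_subset.
    - exact: finX.
    - exact: finite_seq.
    - move=> n /set_mem Xn; apply/mem_set => /=.
      have [s sN ->] := star_indices_decr (XI _ Xn) (HN n Xn).
      by apply/mapP; exists s.
    by move=> n _; exact: F0.
  apply: ub_ereal_sup => _ [N _ <-]; rewrite sumE; apply: esum_ge.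
  exists [set` [seq ffun_of_seq r s | s <- decr_seqs N r]].
    split; first exact: finite_seq.
    by move=> _ /= /mapP[s sN ->]; exact: decr_seqs_star_indices sN.
  by rewrite -fsbig_seq.
apply: ereal_nondecreasing_cvgn => m n mn.
by rewrite lee_fin; exact: star_sum_mono.
Qed.

End StarSeries.

(** * The coefficients of the half-Todd genus *)

Section Main.
Variable R : realType.

Definition double_seq (s : seq nat) := [seq (2 * k)%N | k <- s].

Lemma sumn_double s : sumn (double_seq s) = (2 * sumn s)%N.
Proof. by elim: s => [//|k s IH] /=; rewrite IH mulnDr. Qed.

Lemma double_gt0 s : all (ltn 0%N) (double_seq s) = all (ltn 0%N) s.
Proof. by rewrite all_map; apply: eq_all => k /=; rewrite muln_gt0. Qed.

Lemma size_le_sumn s : all (ltn 0%N) s -> (size s <= sumn s)%N.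
Proof. by elim: s => //= k s IH /andP[k0 /IH]; lia. Qed.

Lemma is_partition_double l : is_partition l -> is_partition (double_seq l).
Proof.
move=> /andP[sl l0]; rewrite /is_partition double_gt0 l0 andbT sorted_map.
by apply: sub_sorted sl => x y /=; rewrite leq_mul2l.
Qed.

Lemma mult_fact_double l : mult_fact (double_seq l) = mult_fact l.
Proof.
have inj : injective (fun k => 2 * k)%N by move=> x y /eqP; rewrite eqn_mul2l => /eqP.
rewrite /mult_fact /double_seq undup_map_inj // big_map; apply: eq_bigr => i _.
by rewrite count_map; congr factorial; apply: eq_count => k /=; rewrite (inj_eq inj).
Qed.

(** The roots of a truncation of [Q] exist over the complex numbers. *)
Lemma formal_roots (Q : nat -> R) D : Q 0%N = 1 ->
  exists ys : seq R[i], forall k, (k <= D)%N ->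
    (Q k)%:C%C = esym_seq ys k.
Proof.
move=> Q0; pose p : {poly R[i]} := \poly_(k < D.+1) (Q k)%:C%C.
have [r pE] := closed_field_poly_normal p.
exists [seq - z^-1 | z <- r] => k kD.
rewrite -(coef_esym_roots k pE); first by rewrite coef_poly ltnS kD.
by rewrite coef_poly /= Q0.
Qed.

Section Roots.
Variables (Q : nat -> R) (D : nat) (ys : seq R[i]).
Hypothesis hQ : is_Td_half Q.
Hypothesis ysE : forall k, (k <= D)%N -> (Q k)%:C%C = esym_seq ys k.

(** The square of [Q] is the Todd series, whose even coefficients are even zeta
    values. *)
Lemma power_sum_roots (Z : nat -> R) k :
  (forall n, n%:R * ((pi ^+ 2) ^+ n / (n.*2.+1)`!%:R) =
    \sum_(k < n) (-1) ^+ k * Z k.+1 *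
       ((pi ^+ 2) ^+ (n - k.+1)%N / ((n - k.+1).*2.+1)`!%:R)) ->
  (0 < k)%N -> (2 * k <= D)%N ->
  power_sum ys (2 * k) = ((-1) ^+ k.-1 * Z k / (2 * pi) ^+ (2 * k))%:C%C.
Proof.
move=> HZ k0 kD.
have pi0 : (pi ^+ 2 : R) != 0 by rewrite expf_neq0 // gt_eqF // pi_gt0.
have QQ := @Td_sinh R Q hQ (pi ^+ 2) (fun k => (-1) ^+ k.-1 * Z k) pi0 HZ k k0.
have H : forall j, (0 < j <= D)%N -> (-1) ^+ j.-1 * power_sum ys j =
    (((1 : series R) + SX - (Q : series R) * Q) j / 2)%:C%C.
  apply: (@newton_unique _ (esym_seq ys)); first exact: esym_seq0.
  move=> n nD; rewrite -newton.
  rewrite -ysE // -(rmorph_nat (real_complex R)) -[LHS]rmorphM /= (Td_half_newton hQ).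
  rewrite rmorph_sum; apply: eq_bigr => i _.
  by rewrite /= -ysE -?rmorphM //; lia.
have k2 : (2 * k)%N = (2 * k).-1.+1 by lia.
have := H (2 * k)%N; rewrite kD muln_gt0 k0 => /(_ isT).
rewrite -signr_odd (_ : odd (2 * k).-1 = true); last by rewrite -[odd _]negbK -oddS -k2 oddM.
rewrite expr1 mulN1r => /eqP; rewrite eqr_oppLR => /eqP ->; rewrite -rmorphN; congr (_%:C%C).
rewrite saddE soppE saddE soneE {1}/SX /ps_X.
have -> : (2 * k == 0)%N = false by lia.
have -> : (2 * k == 1)%N = false by lia.
have -> : (2 * pi) ^+ (2 * k) = (4 * pi ^+ 2) ^+ k :> R.
  by rewrite exprM; congr (_ ^+ _); ring.
by rewrite addr0 add0r mulNr opprK mul2n QQ -mulr_natr mulfK ?pnatr_eq0.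
Qed.

Definition lim_star s : R := limn (fun N => sym_star_sum (recips R N) (double_seq s)).

(** The recursions of augmented monomials and of star sums differ by a sign,
    which the sign [(-1)^(k-1)] of the power sums compensates. Enlarging a part
    by [k] and adjoining a part [k] lead to the same weight, but to lengths
    that differ by one. *)
Lemma aug_monomial_lim_star s : all (ltn 0%N) s -> (2 * sumn s <= D)%N ->
  (sym_star_sum (recips R N) (double_seq s) @[N --> \oo] --> lim_star s)%classic /\
  aug_monomial ys (double_seq s) =
    ((-1) ^+ (sumn s - size s) * lim_star s / (2 * pi) ^+ (2 * sumn s))%:C%C.
Proof.
have [Z [cvgZ newtonZ]] := even_zeta R.
have [n] := ubnP (size s); elim: n s => // n IH [|k s] sn.
  move=> _ _; have E : (fun N => sym_star_sum (recips R N) (double_seq [::])) = fun=> 1.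
    by apply/funext => N; rewrite sym_star_sum0.
  have L : lim_star [::] = 1 by rewrite /lim_star E; exact: lim_cst.
  rewrite L E; split; first exact: cvg_cst.
  by rewrite aug_monomial_nil /= expr0 divr1 mulr1.
move=> /= /andP[k0 s0] sD.
have sD' : (2 * sumn s <= D)%N by lia.
have [cvg_s aug_s] := IH s sn s0 sD'.
have IHu u : u \in bumps k s -> (sym_star_sum (recips R N) (double_seq u) @[N --> \oo]
      --> lim_star u)%classic /\
    aug_monomial ys (double_seq u) =
    (- (-1) ^+ (k + sumn s - (size s).+1) * lim_star u / (2 * pi) ^+ (2 * (k + sumn s)))%:C%C.
  move=> us; have [||cvg_u ->] := IH u _ (bumps_gt0 s0 us).
  - by rewrite (size_bumps us).
  - by rewrite (sumn_bumps us).
  split=> //; rewrite (size_bumps us) (sumn_bumps us).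
  have := size_le_sumn s0 => le_s.
  by rewrite (_ : k + sumn s - size s = (k + sumn s - (size s).+1).+1)%N ?exprS ?mulN1r //; lia.
have cvg_ks : (sym_star_sum (recips R N) (double_seq (k :: s)) @[N --> \oo] -->
    Z k * lim_star s + \sum_(u <- bumps k s) lim_star u)%classic.
  have -> : (fun N => sym_star_sum (recips R N) (double_seq (k :: s))) = fun N =>
    power_sum (recips R N) (2 * k) * sym_star_sum (recips R N) (double_seq s) +
    \sum_(u <- bumps k s) sym_star_sum (recips R N) (double_seq u).
    by apply/funext => N; rewrite /= sym_star_sum_rec bumps_map_double big_map.
  apply: cvgD; first by apply: cvgM => //; exact: cvgZ.
  apply: (@cvgr_sum R _ _ (fun u N => sym_star_sum (recips R N) (double_seq u))).
  by move=> u /IHu[].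
have L : lim_star (k :: s) = Z k * lim_star s + \sum_(u <- bumps k s) lim_star u.
  exact: cvg_lim cvg_ks.
rewrite L; split=> //=.
rewrite aug_monomial_rec bumps_map_double big_map.
rewrite (eq_big_seq _ (fun u us => (IHu u us).2)) aug_s (power_sum_roots newtonZ) //; last by lia.
rewrite -rmorph_sum -rmorphM -rmorphB; congr (_%:C%C).
rewrite -mulr_suml -mulr_sumr.
have -> : (-1) ^+ (k + sumn s - (size s).+1) = (-1) ^+ k.-1 * (-1) ^+ (sumn s - size s) :> R.
  by rewrite -exprD; congr (_ ^+ _); have := size_le_sumn s0; lia.
rewrite mulnDr exprD.
have pi2 : (2 * pi : R) != 0 by rewrite mulf_neq0 ?pnatr_eq0 // gt_eqF // pi_gt0.
have := expf_neq0 (2 * k) pi2; have := expf_neq0 (2 * sumn s) pi2.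
move: ((2 * pi) ^+ (2 * k)) ((2 * pi) ^+ (2 * sumn s)) => a c c0 a0.
by field; rewrite a0 c0.
Qed.

End Roots.

(** Positivity comes from the term with all indices equal to [1], which occurs in
    every truncation. *)
Lemma zeta_starS_lim l L :
  (sym_star_sum (recips R N) (double_seq l) @[N --> \oo] --> L)%classic ->
  zeta_starS (fun i : 'I_(size l) => (2 * nth 0%N l i)%:R : R) = L%:E /\ 0 < L.
Proof.
move=> cvgL.
have sizeE (sg : 'S_(size l)) : size (permute (double_seq l) sg) = size l.
  by rewrite size_map size_enum_ord.
have sumE N : sym_star_sum (recips R N) (double_seq l) =
    \sum_(sg : 'S_(size l)) star_sum (recips R N) (permute (double_seq l) sg).
  by apply: sym_star_sumE; rewrite size_map.
split.
  have cvgE : ((sym_star_sum (recips R N) (double_seq l))%:E @[N --> \oo] --> L%:E)%classic.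
    by apply: cvg_EFin => //; near=> N.
  have cvgZ : ((sym_star_sum (recips R N) (double_seq l))%:E @[N --> \oo] -->
      zeta_starS (fun i : 'I_(size l) => (2 * nth 0%N l i)%:R : R))%classic.
    under eq_fun => N do rewrite sumE -sumEFin.
    apply: cvg_nnesum => sg _; first by near=> N; rewrite lee_fin star_sum_ge0.
    have -> : (fun i : 'I_(size l) => (2 * nth 0%N l (sg i))%:R : R) =
        fun i => (nth 0%N (permute (double_seq l) sg) i)%:R.
      apply/funext => i; rewrite (nth_map i) ?size_enum_ord // nth_ord_enum.
      by rewrite (nth_map 0%N).
    exact: zeta_star_lim.
  by apply: (cvg_unique _ cvgZ cvgE); exact: ereal_hausdorff.
apply: (lt_le_trans ltr01); rewrite -(cvg_lim _ cvgL) //.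
apply: limr_ge; first by apply/cvg_ex; exists L.
near=> N; have N1 : (1 <= N)%N by near: N; exact: nbhs_infty_ge.
rewrite sumE (bigD1 1%g) //= -[leLHS]addr0 lerD //.
  have := star_sum_mono R (permute (double_seq l) (1%g : 'S_(size l))) N1.
  by rewrite star_sum1.
by apply: sumr_ge0 => sg _; exact: star_sum_ge0.
Unshelve. all: by end_near. Qed.

End Main.

Theorem theorem1p1 (R : realType) (Q : nat -> R) (b : seq nat -> R)
    (hQ : is_Td_half Q) (hb : is_genus_coef Q b)
    (l : seq nat) (hl : is_partition l) :
  let b2l := b [seq (2 * k)%N | k <- l] in
  [/\ b2l%:E =
        (((-1) ^+ (sumn l - size l) /
          ((2 * pi) ^+ (2 * sumn l) * (\prod_(i <- undup l) (count_mem i l)`!)%:R))%:E *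
         zeta_starS (fun i : 'I_(size l) => (2 * nth 0%N l i)%:R : R))%E,
      b2l != 0,
      ~~ odd (sumn l - size l) -> 0 < b2l
    & odd (sumn l - size l) -> b2l < 0].
Proof.
move=> b2l.
have [Q0 _] := hQ; have /andP[_ l0] := hl.
have [ys ysE] := formal_roots (sumn (double_seq l)) Q0.
have ysE' k : (k <= 2 * sumn l)%N -> (Q k)%:C%C = esym_seq ys k.
  by rewrite -sumn_double; exact: ysE.
have [cvg_l aug_l] := aug_monomial_lim_star hQ ysE' l0 (leqnn _).
have [zetaE lim_gt0] := zeta_starS_lim cvg_l.
have := genus_coef_aug_monomial hb (is_partition_double hl) ysE.
rewrite aug_l mult_fact_double -[(mult_fact l)%:R](rmorph_nat (real_complex R)).
rewrite -rmorphM => /complexI bE.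
have f0 : 0 < (mult_fact l)%:R :> R.
  by rewrite ltr0n /mult_fact prodn_gt0 // => i; exact: fact_gt0.
have pi2 : 0 < (2 * pi) ^+ (2 * sumn l) :> R by rewrite exprn_gt0 // mulr_gt0 // pi_gt0.
have {}bE : b2l = (-1) ^+ (sumn l - size l) /
    ((2 * pi) ^+ (2 * sumn l) * (mult_fact l)%:R) * lim_star R l.
  have -> : b2l = b (double_seq l) * (mult_fact l)%:R / (mult_fact l)%:R.
    by rewrite mulfK // gt_eqF.
  by rewrite bE; field; rewrite !gt_eqF.
have c0 : 0 < ((2 * pi) ^+ (2 * sumn l) * (mult_fact l)%:R)^-1 * lim_star R l.
  by rewrite mulr_gt0 // invr_gt0 mulr_gt0.
split; first by rewrite zetaE -EFinM -bE.
- by rewrite bE -mulrA mulf_neq0 ?signr_eq0 // gt_eqF.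
- by rewrite bE -mulrA -signr_odd => /negbTE ->; rewrite mul1r.
by rewrite bE -mulrA -signr_odd => ->; rewrite mulN1r oppr_lt0.
Qed.
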